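(* Let $G$ be a connected closed graph on $[n]$, labeled so that the facets of its clique complex are the intervals $F_1=[a_1,b_1],\ldots,F_r=[a_r,b_r]$ with $1=a_1<a_2<\cdots<a_r<b_r=n$, and let $W_i=F_i\cap F_{i+1}$ for $1\le i\le r-1$ be the connected cut sets of $G$. Let $W\subset[n]$ be a non-empty set. Then the following are equivalent: (a) $W$ is a cut set of $G$; (b) $W=W_{j_1}\cup\cdots\cup W_{j_t}$ for some $t\ge 1$ and $1\le j_1<\cdots<j_t\le r-1$, with $\max(W_{j_i})+1<\min(W_{j_{i+1}})$ for $1\le i\le t-1$. Moreover, for such a $W$, $\dim S/P_W(G)\le n+1$, with equality if and only if $|W_{j_i}|=1$ for every $1\le i\le t$.
   Context: Graphs are simple (undirected, no loops or multiple edges). For a graph $G$ on $[n]=\{1,\ldots,n\}$ and a field $K$, let $S=K[x_1,\ldots,x_n,y_1,\ldots,y_n]$ and $f_{ij}=x_iy_j-x_jy_i$ for $i<j$. The binomial edge ideal $J_G\subset S$ is generated by all $f_{ij}$ with $i<j$ and $\{i,j\}\in E(G)$. For $W\subset[n]$, let $G_1,\ldots,G_{c(W)}$ be the connected components of the induced subgraph $G\setminus W$ on $[n]\setminus W$, and let $\tilde G_i$ be the complete graph on $V(G_i)$. Set $P_W(G)=(x_i,y_i: i\in W)+J_{\tilde G_1}+\cdots+J_{\tilde G_{c(W)}}$, a prime ideal of $S$. A non-empty $W\subset[n]$ is a cut set of $G$ if $P_W(G)$ is a minimal prime ideal of $J_G$; equivalently, $c(W\setminus\{i\})<c(W)$ for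 every $i\in W$. The clique complex $\Delta(G)$ is the simplicial complex whose faces are the vertex sets of complete induced subgraphs of $G$; its facets are the maximal cliques. Intervals are integer intervals: $[a,b]=\{m\in\mathbb{Z}: a\le m\le b\}$. A graph $G$ on $[n]$ is closed if (with respect to a suitable labeling of the vertices, which is always fixed) the facets of $\Delta(G)$ are intervals $F_i=[a_i,b_i]$, $1\le i\le r$, which can be ordered such that $1=a_1<\cdots<a_r<b_r=n$. $\dim$ denotes Krull dimension. *)

(* Defs.v *)
From HB Require Import structures.
From mathcomp Require Import all_boot all_algebra.
From mathcomp Require Import boolp.
From mathcomp Require Import mpoly.

Set Implicit Arguments.
Unset Strict Implicit.
Unset Printing Implicit Defensive.

Import GRing.Theory.

(* Graphs on [n] are symmetric irreflexive relations on 'I_n, the element v of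
   'I_n standing for the vertex v.+1 of {1, ..., n}. *)
Section Graphs.
Variables (n : nat) (e : rel 'I_n).

Definition connected_graph : Prop := forall u v, connect e u v.

Definition clique (F : {set 'I_n}) : bool :=
  [forall u in F, forall v in F, (u != v) ==> e u v].

Definition clique_facet (F : {set 'I_n}) : bool := maxset clique F.

Definition del_rel (W : {set 'I_n}) : rel 'I_n :=
  [rel u v | [&& u \notin W, v \notin W & e u v]].

Definition components (W : {set 'I_n}) : {set {set 'I_n}} :=
  [set [set v in ~: W | connect (del_rel W) u v] | u in ~: W].

End Graphs.

Definition complete_on n (C : {set 'I_n}) : rel 'I_n :=
  [rel u v | [&& u != v, u \in C & v \in C]].

Definition vertex_itv n (c d : nat) : {set 'I_n} := [set v : 'I_n | c <= v.+1 <= d].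

(* Facets are indexed from 1 to r; the values of a and b elsewhere are junk. *)
Definition closed_with_facets n (e : rel 'I_n) (r : nat) (a b : nat -> nat) :
    Prop :=
  (forall F : {set 'I_n},
     clique_facet e F <-> exists2 i, (1 <= i <= r) & F = vertex_itv n (a i) (b i))
  /\ [/\ (1 <= r), a 1 = 1, (forall i, (1 <= i < r) -> (a i < a i.+1)),
         (a r < b r) & b r = n].

Definition conn_cut n (a b : nat -> nat) (i : nat) : {set 'I_n} :=
  vertex_itv n (a i) (b i) :&: vertex_itv n (a i.+1) (b i.+1).

(* Both are only meaningful on non-empty sets. *)
Definition set_max n (W : {set 'I_n}) : nat := \max_(v in W) v.+1.
Definition set_min n (W : {set 'I_n}) : nat := \big[minn/n]_(v in W) v.+1.

(* js is the list j_1, ..., j_t. *)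
Definition cut_decomposition n (r : nat) (a b : nat -> nat) (W : {set 'I_n})
    (js : seq nat) : Prop :=
  [/\ (1 <= size js),
      sorted ltn js /\ (forall j, j \in js -> (1 <= j <= r.-1)),
      W = \bigcup_(j <- js) conn_cut n a b j &
      sorted (fun j k => (set_max (conn_cut n a b j) + 1
                          < set_min (conn_cut n a b k))) js].

Local Open Scope ring_scope.

(* Ideals are the boolean predicates of [ring_quotient]; since membership in an
   ideal over an arbitrary field is not decidable, they are built with the
   classical truth value [`[< P >]], so that every ideal is such a predicate. *)
Section Ideals.
Variable R : comNzRingType.

Definition ideal_gen (A : R -> Prop) : {pred R} := fun f =>
  `[< exists s : seq (R * R),
        (forall p, p \in s -> A p.2) /\ f = \sum_(p <- s) p.1 * p.2 >].

Definition ideal_add (I J : {pred R}) : {pred R} := fun f =>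
  `[< exists g h, [/\ g \in I, h \in J & f = g + h] >].

Definition ideal_sum (T : finType) (D : {set T}) (I : T -> {pred R}) :
    {pred R} := fun f =>
  `[< exists g : T -> R,
        (forall t, t \in D -> g t \in I t) /\ f = \sum_(t in D) g t >].

(* [idealr_closed] includes properness. *)
Definition is_prime_ideal (P : {pred R}) : Prop :=
  idealr_closed P /\ prime_idealr_closed P.

Definition is_minimal_prime_of (J P : {pred R}) : Prop :=
  [/\ is_prime_ideal P, {subset J <= P} &
      forall Q : {pred R}, is_prime_ideal Q ->
        {subset J <= Q} -> {subset Q <= P} -> {subset P <= Q}].

(* p 0, ..., p d is a chain of length d; the values p i with i > d are junk. *)
Definition prime_chain (d : nat) (p : nat -> {pred R}) : Prop :=
  (forall i, (i <= d)%N -> is_prime_ideal (p i)) /\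
  (forall i, (i < d)%N ->
     {subset p i <= p i.+1} /\ ~ {subset p i.+1 <= p i}).

Definition has_krull_dim (d : nat) : Prop :=
  (exists p, prime_chain d p) /\ (forall m p, prime_chain m p -> (m <= d)%N).

Definition ideal_like (I : {pred R}) : Prop :=
  0 \in I /\ forall c, {in I &, forall u v, c * u + v \in I}.

Lemma ideal_gen_like (A : R -> Prop) : ideal_like (ideal_gen A).
Proof.
split; first by apply/asboolP; exists [::]; rewrite big_nil; split.
move=> c u v /asboolP[s [As ->]] /asboolP[t [At ->]]; apply/asboolP.
exists ([seq (c * p.1, p.2) | p <- s] ++ t); split.
  move=> p; rewrite mem_cat => /orP[/mapP[q qs ->]|/At//]; exact: As qs.
rewrite big_cat big_map big_distrr /=; congr (_ + _).
by apply: eq_bigr => p _; rewrite mulrA.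
Qed.

Lemma ideal_add_like (I J : {pred R}) :
  ideal_like I -> ideal_like J -> ideal_like (ideal_add I J).
Proof.
move=> [I0 IM] [J0 JM]; split.
  by apply/asboolP; exists 0, 0; rewrite addr0.
move=> c u v /asboolP[g [h [gI hJ ->]]] /asboolP[g' [h' [gI' hJ' ->]]].
apply/asboolP; exists (c * g + g'), (c * h + h'); split; [exact: IM|exact: JM|].
by rewrite mulrDr addrACA.
Qed.

Lemma ideal_sum_like (T : finType) (D : {set T}) (I : T -> {pred R}) :
  (forall t, t \in D -> ideal_like (I t)) -> ideal_like (ideal_sum D I).
Proof.
move=> HI; split.
  apply/asboolP; exists (fun=> 0); split; last by rewrite big1.
  by move=> t /HI[].
move=> c u v /asboolP[g [gI ->]] /asboolP[h [hI ->]]; apply/asboolP.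
exists (fun t => c * g t + h t); split.
  by move=> t tD; apply: (HI t tD).2; [exact: gI|exact: hI].
by rewrite big_split /= big_distrr.
Qed.

End Ideals.

Section BinomialEdgeIdeals.
Variables (K : fieldType) (n : nat).

Notation S := {mpoly K[n + n]}.

Definition xvar (i : 'I_n) : S := 'X_(lshift n i).
Definition yvar (i : 'I_n) : S := 'X_(rshift n i).

Definition fbin (i j : 'I_n) : S := xvar i * yvar j - xvar j * yvar i.

Definition binomial_edge_ideal (e : rel 'I_n) : {pred S} :=
  ideal_gen (fun f => exists i j : 'I_n, [/\ (i < j)%N, e i j & f = fbin i j]).

Definition vars_ideal (W : {set 'I_n}) : {pred S} :=
  ideal_gen (fun f => exists2 i, i \in W & f = xvar i \/ f = yvar i).

Definition PW (e : rel 'I_n) (W : {set 'I_n}) : {pred S} :=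
  ideal_add (vars_ideal W)
    (ideal_sum (components e W) (fun C => binomial_edge_ideal (complete_on C))).

Definition cut_set (e : rel 'I_n) (W : {set 'I_n}) : Prop :=
  W != set0 /\ is_minimal_prime_of (binomial_edge_ideal e) (PW e W).

Lemma ideal_gen_eval0 (A : S -> Prop) (f : S) :
  (forall g, A g -> g.@[fun=> 0] = 0) -> f \in ideal_gen A -> f.@[fun=> 0] = 0.
Proof.
move=> A0 /asboolP[s [As ->]]; rewrite raddf_sum big_seq big1 //= => p ps.
by rewrite mevalM (A0 p.2) ?mulr0 //; apply: As.
Qed.

Lemma PW_closed e W : idealr_closed (PW e W).
Proof.
have [|z M] := @ideal_add_like _ (vars_ideal W) (ideal_sum (components e W)
    (fun C => binomial_edge_ideal (complete_on C))) (ideal_gen_like _).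
  by apply: ideal_sum_like => C _; apply: ideal_gen_like.
split=> //; apply/negP => /asboolP[g [h [gI /asboolP[k [kI ->]]]]].
move/(congr1 (meval (fun=> 0))); rewrite meval1 mevalD raddf_sum /=.
rewrite (ideal_gen_eval0 _ gI); last first.
  by move=> _ [i _ [] ->]; rewrite mevalXU.
rewrite big1 ?addr0 => [/eqP|C /kI]; first by rewrite oner_eq0.
apply: ideal_gen_eval0 => _ [i [j [_ _ ->]]].
by rewrite mevalB !mevalM !mevalXU !mulr0 subr0.
Qed.

HB.instance Definition _ e W := isIdealr.Build S (PW e W) (PW_closed e W).

Definition quotPW (e : rel 'I_n) (W : {set 'I_n}) : comNzRingType :=
  {ideal_quot (PW e W : idealr _)}.

End BinomialEdgeIdeals.

(* Main.v *)
Require Import Defs.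
From HB Require Import structures.
From mathcomp Require Import mpoly.
From mathcomp Require Import all_boot all_algebra boolp zify ring.

(* Let x_v |-> t_v, y_v |-> t_v u_C for v in the component C of G \ W, and
   x_v, y_v |-> 0 for v in W. Exchanging y_i x_j for x_i y_j inside a component
   shows that the kernel of this map is P_W, so P_W is prime. Comparing P_W with
   P_T for proper subsets T of W, P_W is a minimal prime of J_G exactly when
   every i in W is adjacent to two components of G \ W. In a closed graph any
   two vertices between the ends of an edge are adjacent, so this condition says
   that the maximal runs of consecutive vertices in W are among the W_j.

   S / P_W embeds in a polynomial ring in n - |W| + c(W) variables, and killing
   these variables one by one gives a chain of primes of that length. Longer
   chains do not exist: picking x_i in p_(i+1) but not in p_i gives algebraically
   independent elements, as one sees from the lexicographically least exponent
   of a relation. Finally c(W) = t + 1 for the union W of W_(j_1), ..., W_(j_t),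
   so the dimension is n + 1 - sum_i (|W_(j_i)| - 1). *)

Set Implicit Arguments.
Unset Strict Implicit.
Unset Printing Implicit Defensive.

Import GRing.Theory.

(** * The kernel description of P_W *)

Section Kernel.
Local Open Scope ring_scope.
Variables (K : fieldType) (n : nat) (e : rel 'I_n).
Hypothesis e_sym : symmetric e.
Local Notation S := {mpoly K[n + n]}.
Local Notation x := (@xvar K n).
Local Notation y := (@yvar K n).
Implicit Types (W C : {set 'I_n}) (u v w : 'I_n).

Lemma del_rel_sym W : connect_sym (del_rel e W).
Proof. by apply: sym_connect_sym => u v; rewrite /del_rel /= e_sym andbCA. Qed.

Lemma connect_del_relN W u v : connect (del_rel e W) u v -> u \notin W ->
  v \notin W.
Proof.
move=> /connectP[p]; elim: p u => [u _ -> //|w p IH u /= /andP[/and3P[_ wW _]]].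
by move=> pp vE uW; apply: (IH w).
Qed.

Definition comp_root W v := fingraph.root (del_rel e W) v.

Lemma comp_root_eq W u v :
  (comp_root W u == comp_root W v) = connect (del_rel e W) u v.
Proof. by rewrite /comp_root root_connect //; apply: del_rel_sym. Qed.

Lemma comp_rootN W v : v \notin W -> comp_root W v \notin W.
Proof. by apply: connect_del_relN; apply: connect_root. Qed.

(* The parameters t_v and u_C are the variables x_v and y_w of the same ring S,
   where w is the representative of C. *)
Definition param_var W (k : 'I_(n + n)) : S :=
  match split k with
  | inl v => if v \in W then 0 else x v
  | inr v => if v \in W then 0 else x v * y (comp_root W v)
  end.

Definition param W : S -> S := mmap (@mpolyC _ K) (param_var W).
HB.instance Definition _ W := GRing.RMorphism.on (param W).

Lemma split_lshift (v : 'I_n) : split (lshift n v) = inl v.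
Proof. exact: (unsplitK (inl v)). Qed.
Lemma split_rshift (v : 'I_n) : split (rshift n v) = inr v.
Proof. exact: (unsplitK (inr v)). Qed.

Lemma param_x W v : param W (x v) = if v \in W then 0 else x v.
Proof. by rewrite /param mmapX mmap1U /param_var split_lshift. Qed.

Lemma param_y W v :
  param W (y v) = if v \in W then 0 else x v * y (comp_root W v).
Proof. by rewrite /param mmapX mmap1U /param_var split_rshift. Qed.

Lemma param_fbin W u v : u \notin W -> v \notin W ->
  param W (fbin K u v) = x u * x v * (y (comp_root W v) - y (comp_root W u)).
Proof.
move=> uW vW; rewrite /fbin rmorphB !rmorphM /= !param_x !param_y.
by rewrite (negPf uW) (negPf vW) mulrBr mulrA [x v * (_ * _)]mulrA (mulrC (x v)).
Qed.

Lemma xvar_neq0 v : x v != 0.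
Proof. by rewrite -msize_poly_eq0 msizeX. Qed.
Lemma yvar_neq0 v : y v != 0.
Proof. by rewrite -msize_poly_eq0 msizeX. Qed.

Lemma yvar_inj : injective y.
Proof.
move=> u v /(congr1 (mcoeff U_(rshift n v))).
rewrite !mcoeffXU eqxx; case: eqP => [/rshift_inj //|_] /eqP.
by rewrite eq_sym oner_eq0.
Qed.

(** A product in a domain: only the difference of the two y-variables can vanish, and it does so
    when the representatives agree. *)
Lemma param_fbin_eq0 W u v : u \notin W -> v \notin W ->
  (param W (fbin K u v) == 0) = connect (del_rel e W) u v.
Proof.
move=> uW vW; rewrite param_fbin // !mulf_eq0 !(negPf (xvar_neq0 _)) /= subr_eq0.
by rewrite (inj_eq yvar_inj) eq_sym comp_root_eq.
Qed.

Lemma fbin_swap u v : fbin K u v = - fbin K v u.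
Proof. by rewrite /fbin opprB. Qed.

Lemma ideal_gen_in (R : comNzRingType) (A : R -> Prop) f :
  A f -> f \in ideal_gen A.
Proof.
move=> Af; apply/asboolP; exists [:: (1, f)].
by split=> [p|]; [rewrite inE => /eqP ->|rewrite big_seq1 mul1r].
Qed.

Lemma ideal_gen_sub (R : comNzRingType) (A : R -> Prop) (Q : {pred R}) :
  ideal_like Q -> (forall f, A f -> f \in Q) -> {subset ideal_gen A <= Q}.
Proof.
move=> [Q0 QM] AQ f /asboolP[s [As ->]].
elim: s As => [|p s IH] As; first by rewrite big_nil.
rewrite big_cons; apply: QM; first by apply/AQ/As/mem_head.
by apply: IH => q qs; apply: As; rewrite inE qs orbT.
Qed.

Lemma ideal_likeM (R : comNzRingType) (Q : {pred R}) f g :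
  ideal_like Q -> g \in Q -> f * g \in Q.
Proof. by move=> [Q0 QM] gQ; rewrite -[f * g]addr0 QM. Qed.

Lemma idealr_like (R : comNzRingType) (Q : {pred R}) :
  idealr_closed Q -> ideal_like Q.
Proof. by case. Qed.

(** Inclusions of P_W are tested on generators: two vertices of a component set are both connected
    to the vertex defining it, hence to each other. *)
Lemma PW_sub W (Q : {pred S}) : ideal_like Q ->
    (forall v, v \in W -> x v \in Q /\ y v \in Q) ->
    (forall u v, u \notin W -> v \notin W -> connect (del_rel e W) u v ->
       fbin K u v \in Q) ->
  {subset @PW K n e W <= Q}.
Proof.
move=> Qi Qv Qf _ /asboolP[g [h [gV hS ->]]].
have QD (f1 f2 : S) : f1 \in Q -> f2 \in Q -> f1 + f2 \in Q.
  by move=> ? ?; rewrite -[f1]mul1r Qi.2.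
apply: (QD).
  by move: g gV; apply: (ideal_gen_sub Qi) => f [v /Qv[xQ yQ]] [] ->.
move: hS => /asboolP[k [kC ->]].
apply: (big_ind (fun f : S => f \in Q)) => [||C CW]; [exact: Qi.1|exact: QD|].
move: (k C) (kC _ CW); apply: (ideal_gen_sub Qi) => _ [u [v [_ /and3P[_ uC vC] ->]]].
have /imsetP[w _ CE] := CW; move: uC vC; rewrite CE !inE.
move=> /andP[uW wu] /andP[vW wv]; apply: Qf => //.
by apply: connect_trans wv; rewrite del_rel_sym.
Qed.

Lemma vars_in_PW W v : v \in W -> x v \in @PW K n e W /\ y v \in @PW K n e W.
Proof.
have aux f : f \in @vars_ideal K n W -> f \in @PW K n e W.
  move=> fV; apply/asboolP; exists f, 0; rewrite addr0; split=> //.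
  apply/asboolP; exists (fun=> 0); split; last by rewrite big1.
  by move=> C _; case: (ideal_gen_like
    (fun f : S => exists i j : 'I_n, [/\ (i < j)%N, complete_on C i j & f = fbin K i j])).
by move=> vW; split; apply/aux/ideal_gen_in; exists v => //; [left|right].
Qed.

Lemma fbin_in_PW W u v : u \notin W -> v \notin W ->
  connect (del_rel e W) u v -> fbin K u v \in @PW K n e W.
Proof.
move=> uW vW cuv; case: (eqVneq u v) => [->|uv].
  by rewrite /fbin subrr; case: (@PW_closed K n e W).
(* Generators are indexed by increasing pairs; the other order only changes the sign. *)
wlog lt_uv : u v uW vW cuv uv / (u < v)%N.
  move=> Hw; have [|lt_vu|/val_inj E] := ltngtP u v; first exact: Hw.
    by rewrite fbin_swap rpredN; apply: Hw => //; rewrite 1?del_rel_sym // eq_sym.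
  by rewrite E eqxx in uv.
set C := [set w in ~: W | connect (del_rel e W) u w].
have CW : C \in components e W by apply/imsetP; exists u; rewrite ?inE.
apply/asboolP; exists 0, (fbin K u v); rewrite add0r; split=> //.
  by case: (ideal_gen_like
    (fun f : S => exists2 i, i \in W & f = x i \/ f = y i)).
apply/asboolP; exists (fun D => if D == C then fbin K u v else 0); split.
  move=> D _; case: eqP => [->|_].
    apply: ideal_gen_in; exists u, v; split=> //=.
    by rewrite /complete_on /= uv !inE uW vW connect0 cuv.
  by case: (ideal_gen_like
    (fun f : S => exists i j : 'I_n, [/\ (i < j)%N, complete_on D i j & f = fbin K i j])).
by rewrite (bigD1 C) //= eqxx big1 ?addr0 // => D /andP[_ /negPf ->].
Qed.

Lemma rmorph_ker_prime (f : {rmorphism S -> S}) :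
  is_prime_ideal [pred p | f p == 0].
Proof.
split; first split.
- by rewrite inE rmorph0.
- by rewrite inE rmorph1 oner_eq0.
- by move=> a u v; rewrite !inE rmorphD rmorphM => /eqP -> /eqP ->; rewrite mulr0 addr0.
by move=> u v; rewrite !inE rmorphM mulf_eq0.
Qed.

Lemma PW_sub_ker W : {subset @PW K n e W <= [pred p | param W p == 0]}.
Proof.
apply: PW_sub.
- exact: idealr_like (rmorph_ker_prime (param W)).1.
- by move=> v vW; rewrite !inE param_x param_y vW.
- by move=> u v uW vW cuv; rewrite inE param_fbin_eq0.
Qed.

Lemma PW_mulr W (f g : S) : g \in @PW K n e W -> f * g \in @PW K n e W.
Proof. exact/ideal_likeM/idealr_like/PW_closed. Qed.

(** * Monomials under the parametrization *)

Definition mono_free W (m : 'X_{1..n + n}) : Prop :=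
  forall v, v \in W -> m (lshift n v) = 0%N /\ m (rshift n v) = 0%N.

(** On [W] this disagrees with [param_var], which is 0 there; [param_mpolyX] therefore assumes
    [mono_free]. *)
Definition param_mono_var W (k : 'I_(n + n)) : 'X_{1..n + n} :=
  match split k with
  | inl v => U_(lshift n v)
  | inr v => (U_(lshift n v) + U_(rshift n (comp_root W v)))%MM
  end.

Definition param_mono W (m : 'X_{1..n + n}) : 'X_{1..n + n} :=
  (\sum_k param_mono_var W k *+ m k)%MM.

Lemma param_mpolyX W m : mono_free W m -> param W 'X_[m] = 'X_[param_mono W m].
Proof.
move=> mW; rewrite /param mmapX /mmap1 /param_mono -mprodXnE.
apply: eq_bigr => k _; rewrite -[k]splitK /param_var /param_mono_var.
case: (split k) => v /=; rewrite ?split_lshift ?split_rshift.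
  by case: ifP => [/mW[-> _]|_]; rewrite ?expr0.
by case: ifP => [/mW[_ ->]|_]; rewrite ?expr0 // mpolyXD.
Qed.

Lemma mono_not_free W m : ~ mono_free W m ->
  param W 'X_[m] = 0 /\ 'X_[m] \in @PW K n e W.
Proof.
move=> /existsNP[v /not_implyP[vW mv]].
have [k [mk pk kP]] : exists k, [/\ m k != 0%N, param_var W k = 0
    & 'X_k \in @PW K n e W].
  case: (eqVneq (m (lshift n v)) 0%N) => [m0|mN0]; last first.
    exists (lshift n v); split=> //; last by case: (vars_in_PW vW).
    by rewrite /param_var split_lshift vW.
  exists (rshift n v); split; last by case: (vars_in_PW vW).
    by apply/eqP => m1; apply: mv.
  by rewrite /param_var split_rshift vW.
split.
  by rewrite /param mmapX /mmap1 (bigD1 k) //= pk expr0n (negPf mk) mul0r.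
have -> : m = (m - U_(k) + U_(k))%MM by rewrite submK // lep1mP.
by rewrite mpolyXD; apply: PW_mulr.
Qed.

(** Together with [param_monoEy] this reads off what an exchange preserves: the degree at each
    vertex and the y-degree of each component. *)
Lemma param_monoEx W m v :
  param_mono W m (lshift n v) = (m (lshift n v) + m (rshift n v))%N.
Proof.
rewrite /param_mono mnm_sumE big_split_ord /=; congr addn.
  rewrite (bigD1 v) //= big1 => [|u uv].
    by rewrite addn0 mulmnE /param_mono_var split_lshift mnm1E eqxx mul1n.
  rewrite mulmnE /param_mono_var split_lshift mnm1E.
  by rewrite (inj_eq (@lshift_inj _ _)) (negPf uv).
rewrite (bigD1 v) //= big1 => [|u uv].
  by rewrite addn0 mulmnE /param_mono_var split_rshift mnmDE !mnm1E eqxx eq_rlshift mul1n.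
rewrite mulmnE /param_mono_var split_rshift mnmDE !mnm1E eq_rlshift.
by rewrite (inj_eq (@lshift_inj _ _)) (negPf uv).
Qed.

Lemma param_monoEy W m w :
  param_mono W m (rshift n w)
    = (\sum_(v | comp_root W v == w) m (rshift n v))%N.
Proof.
rewrite /param_mono mnm_sumE big_split_ord /= big1 => [|u _]; last first.
  by rewrite mulmnE /param_mono_var split_lshift mnm1E eq_lrshift.
rewrite add0n [RHS]big_mkcond /=; apply: eq_bigr => u _.
rewrite mulmnE /param_mono_var split_rshift mnmDE !mnm1E eq_lrshift.
by rewrite (inj_eq (@rshift_inj _ _)); case: eqP => _; rewrite ?mul1n.
Qed.

(* Exchange: replacing y_i * x_j by x_i * y_j inside a component does not
   change a monomial modulo PW nor its image under the parametrization. *)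
Lemma param_mono_congr W m m' : mono_free W m -> mono_free W m' ->
  param_mono W m = param_mono W m' -> 'X_[m] - 'X_[m'] \in @PW K n e W.
Proof.
move=> + m'W.
(* Induction on the surplus of y-exponents of [m] over [m']; truncated subtraction ignores the
   vertices where [m] has fewer. *)
have [N] := ubnP (\sum_v (m (rshift n v) - m' (rshift n v)))%N.
elim: N m => // N IH m leN mW E.
have Ex v : (m (lshift n v) + m (rshift n v) = m' (lshift n v) + m' (rshift n v))%N.
  by rewrite -!(param_monoEx W) E.
have Ey w : (\sum_(v | comp_root W v == w) m (rshift n v) =
             \sum_(v | comp_root W v == w) m' (rshift n v))%N.
  by rewrite -!param_monoEy E.
case: (pickP (fun v => m' (rshift n v) < m (rshift n v))%N) => [i lti|Hle]; last first.
  suff -> : m = m' by rewrite subrr; case: (@PW_closed K n e W).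
  (* Without surplus the y-exponents compare termwise, and equal sums over a component force
     equality. *)
  have yE v : m (rshift n v) = m' (rshift n v).
    have : (\sum_(u | comp_root W u == comp_root W v) m (rshift n u)
      == \sum_(u | comp_root W u == comp_root W v) m' (rshift n u))%N.
      by rewrite Ey.
    have leq_y u : comp_root W u == comp_root W v ->
        (m (rshift n u) <= m' (rshift n u) ?= iff
          (m (rshift n u) == m' (rshift n u)))%N.
      by move=> _; split=> //; rewrite leqNgt Hle.
    rewrite (leqif_sum leq_y) => /forall_inP/(_ v); rewrite eqxx.
    by move=> /(_ isT)/eqP.
  apply/mnmP => k; rewrite -[k]splitK; case: (split k) => v /=; last exact: yE.
  by move: (Ex v); rewrite yE => /addIn.
(* A surplus at [i] is balanced by a deficit at some [j] of the same component. *)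
have [j jr ltj] : exists2 j, comp_root W j == comp_root W i &
    (m (rshift n j) < m' (rshift n j))%N.
  apply/exists_inP; apply: contraT; rewrite negb_exists_in => /forall_inP Hj.
  have := Ey (comp_root W i); rewrite (bigD1 i) //= [RHS](bigD1 i) //=.
  move/eqP; rewrite eqn_leq => /andP[+ _]; rewrite leqNgt => /negP[].
  rewrite -addSn leq_add //.
  by apply: leq_sum => v /andP[/Hj]; rewrite -leqNgt.
have ij : i != j by apply: contraTneq lti => ->; lia.
have iW : i \notin W by apply/negP => /mW[_ mi]; move: lti; rewrite mi.
have jW : j \notin W by apply/negP => /m'W[_ mj]; move: ltj; rewrite mj.
(* The degrees at [j] agree, so the deficit in $y_j$ leaves a factor $x_j$ in [m]. *)
have xj : (0 < m (lshift n j))%N by move: (Ex j) ltj; lia.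
set d := (m - (U_(rshift n i) + U_(lshift n j)))%MM.
have mE : m = (d + (U_(rshift n i) + U_(lshift n j)))%MM.
  rewrite submK //; apply/mnm_lepP => k; rewrite mnmDE !mnm1E.
  case: (eqVneq (rshift n i) k) => [<-|_]; last first.
    by case: (eqVneq (lshift n j) k) => [<-|_].
  by rewrite eq_lrshift; lia.
pose m2 := (d + (U_(rshift n j) + U_(lshift n i)))%MM.
have m2x v : (m2 (lshift n v) + (v == j) = m (lshift n v) + (v == i))%N.
  rewrite [in RHS]mE /m2 !mnmDE !mnm1E !eq_rlshift !(inj_eq (@lshift_inj _ _)).
  by rewrite ![v == _]eq_sym; lia.
have m2y v : (m2 (rshift n v) + (v == i) = m (rshift n v) + (v == j))%N.
  rewrite [in RHS]mE /m2 !mnmDE !mnm1E !eq_lrshift !(inj_eq (@rshift_inj _ _)).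
  by rewrite ![v == _]eq_sym; lia.
have diffP : 'X_[m] - 'X_[m2] \in @PW K n e W.
  have -> : 'X_[m] - 'X_[m2] = - 'X_[d] * fbin K i j.
    rewrite {1}mE /m2 !mpolyXD /fbin /xvar /yvar; ring.
  by apply: PW_mulr; apply: fbin_in_PW; rewrite // -comp_root_eq eq_sym.
rewrite -[X in X - _](subrK ('X_[m2] : S)) -addrA.
apply: rpredD => //; apply: IH.
- move: leN; rewrite ltnS; apply: leq_trans.
  rewrite (bigD1 i) //= [X in (_ <= X)%N](bigD1 i) //= -addSn.
  apply: leq_add; first by move: (m2y i); rewrite eqxx (negPf ij); lia.
  apply: leq_sum => v vi; move: (m2y v); rewrite (negPf vi).
  by case: (eqVneq v j) => [->|_]; lia.
- move=> v vW; have [m1 m0] := mW v vW.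
  have vi : (v == i) = false by apply: contraNF iW => /eqP <-.
  have vj : (v == j) = false by apply: contraNF jW => /eqP <-.
  by move: (m2x v) (m2y v); rewrite vi vj m1 m0; lia.
- rewrite -E; apply/mnmP => k; rewrite -[k]splitK; case: (split k) => v /=.
    by rewrite !param_monoEx; move: (m2x v) (m2y v); lia.
  rewrite !param_monoEy.
  have H (b : 'I_n) : comp_root W b == comp_root W i ->
    (\sum_(u | comp_root W u == v) (u == b) = (comp_root W i == v))%N.
    move=> /eqP bi; rewrite -bi big_mkcond (bigD1 b) //= eqxx big1 ?addn0 => [|u /negPf ->].
      by case: ifP.
    by case: ifP.
  apply: (@addIn (comp_root W i == v)).
  rewrite -{1}(H i) // -(H j) // -!big_split /=.
  by apply: eq_bigr => u _; rewrite m2y.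
Qed.

(** Choose a monomial over every image exponent and let [L] be the linear map back to these. Modulo
    P_W, [L (param W q)] equals [q] for every monomial [q] of [p], hence for [p] itself; so
    [param W p = 0] puts [p] in P_W. *)
Lemma PW_ker W p : (p \in @PW K n e W) = (param W p == 0).
Proof.
apply/idP/idP => [/PW_sub_ker //|/eqP p0].
pose good m mu := mono_free W m /\ param_mono W m = mu.
pose rep mu := if pselect (exists m, good m mu) is left ex then projT1 (cid ex)
  else 0%MM.
have repP m : mono_free W m -> good (rep (param_mono W m)) (param_mono W m).
  move=> mW; rewrite /rep; case: pselect => [ex|[]]; last by exists m.
  exact: (projT2 (cid ex)).
(* A degree bound on the images of the monomials of [p] makes [L] a finite sum. *)
pose b := (\max_(m <- msupp p) (mdeg (param_mono W m)).+1)%N.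
pose L (q : S) : S := \sum_(mu : bmultinom (n + n) b) q@_mu *: 'X_[rep mu].
have L0 : L 0 = 0 by rewrite /L big1 // => mu _; rewrite mcoeff0 scale0r.
have LD q q' : L (q + q') = L q + L q'.
  by rewrite /L -big_split /=; apply: eq_bigr => mu _; rewrite mcoeffD scalerDl.
have LZ c q : L (c *: q) = c *: L q.
  by rewrite /L scaler_sumr; apply: eq_bigr => mu _; rewrite mcoeffZ scalerA.
have LX mu : (mdeg mu < b)%N -> L 'X_[mu] = 'X_[rep mu].
  move=> lt_mu; rewrite /L (bigD1 (BMultinom lt_mu)) //= mcoeffX eqxx scale1r.
  rewrite big1 ?addr0 // => nu; rewrite bmeqP /= mcoeffX eq_sym => /negPf ->.
  by rewrite scale0r.
suff H s : {subset s <= msupp p} ->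
    let q := \sum_(m <- s) p@_m *: 'X_[m] in q - L (param W q) \in @PW K n e W.
  by move: (H (msupp p)) => /(_ (fun _ => id)) /=; rewrite -mpolyE p0 L0 subr0.
rewrite /=; elim: s => [|m s IH] sub.
  by rewrite !big_nil rmorph0 L0 subr0; case: (@PW_closed K n e W).
rewrite !big_cons rmorphD /= LD opprD addrACA; apply: rpredD; last first.
  by apply: IH => q qs; apply: sub; rewrite inE qs orbT.
have -> : param W (p@_m *: 'X_[m]) = p@_m *: param W 'X_[m].
  by rewrite /param mmapZ mul_mpolyC.
rewrite LZ -scalerBr -mul_mpolyC; apply: PW_mulr.
case: (pselect (mono_free W m)) => [mW|/mono_not_free[-> XP]]; last by rewrite L0 subr0.
rewrite param_mpolyX // LX; last first.
  by apply: (leq_bigmax_seq (F := fun m => (mdeg (param_mono W m)).+1)); rewrite ?sub ?mem_head.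
have [rW rE] := repP m mW.
by apply: param_mono_congr => //; rewrite rE.
Qed.

Lemma PW_prime W : is_prime_ideal (@PW K n e W).
Proof.
have -> : @PW K n e W = [pred p | param W p == 0] :> {pred S}.
  by apply/funext => p; have := PW_ker W p; rewrite unfold_in.
exact: rmorph_ker_prime.
Qed.

End Kernel.

(** * Minimal primes and cut points *)

Section CutSets.
Local Open Scope ring_scope.
Variables (K : fieldType) (n : nat) (e : rel 'I_n).
Hypothesis e_sym : symmetric e.
Local Notation S := {mpoly K[n + n]}.
Local Notation x := (@xvar K n).
Local Notation y := (@yvar K n).
Implicit Types (W T : {set 'I_n}) (Q : {pred S}).

Lemma edge_ideal_sub_PW W : {subset binomial_edge_ideal e <= @PW K n e W}.
Proof.
apply: ideal_gen_sub; first exact: idealr_like (@PW_closed K n e W).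
move=> _ [u [v [_ euv ->]]]; rewrite PW_ker //.
case: (boolP ((u \in W) || (v \in W))) => [|/norP[uW vW]].
  rewrite /fbin rmorphB !rmorphM /= !param_x !param_y.
  by case/orP => ->; rewrite ?(mul0r, mulr0) subrr.
by rewrite param_fbin_eq0 //; apply: connect1; rewrite /del_rel /= uW vW.
Qed.

(* For a prime Q containing f_uv and f_vw but not both of x_v and y_v,
   x_v f_uw = x_u f_vw + x_w f_uv (and the same with y) gives f_uw in Q. *)
Lemma prime_fbin_connect Q W u v :
    is_prime_ideal Q -> {subset binomial_edge_ideal e <= Q} ->
    (forall i, i \notin W -> ~~ ((x i \in Q) && (y i \in Q))) ->
    u \notin W -> connect (del_rel e W) u v ->
  fbin K u v \in Q.
Proof.
move=> [Qc Qp] JQ WQ uW /connectP[p]; elim/last_ind: p v => [|p w IH] v.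
  by move=> _ ->; rewrite /fbin subrr; case: Qc.
rewrite rcons_path last_rcons => /andP[pp /and3P[vW wW evw]] ->.
have {IH} := IH _ pp erefl; set z := last u p in vW evw *.
have Qi := idealr_like Qc.
have QD (f g : S) : f \in Q -> g \in Q -> f + g \in Q.
  by move=> fQ gQ; rewrite -[f]mul1r Qi.2.
have QN (f : S) : f \in Q -> - f \in Q.
  by move=> fQ; rewrite -mulN1r ideal_likeM.
have fzw : fbin K z w \in Q.
  have gen (i j : 'I_n) : (i < j)%N -> e i j -> fbin K i j \in Q.
    by move=> lt eij; apply/JQ/ideal_gen_in; exists i, j.
  have [lt|lt|/val_inj E] := ltngtP z w; first exact: gen.
    by rewrite fbin_swap; apply/QN/gen; rewrite // e_sym.
  by rewrite E /fbin subrr; case: Qc.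
move=> fuz; have Hx : x z * fbin K u w \in Q.
  have -> : x z * fbin K u w = x u * fbin K z w + x w * fbin K u z.
    by rewrite /fbin; ring.
  by apply: QD; apply: ideal_likeM.
have Hy : y z * fbin K u w \in Q.
  have -> : y z * fbin K u w = y u * fbin K z w + y w * fbin K u z.
    by rewrite /fbin; ring.
  by apply: QD; apply: ideal_likeM.
have := WQ z vW; have := Qp _ _ Hx; have := Qp _ _ Hy.
by case: (fbin K u w \in Q); rewrite ?orbT // !orbF => -> ->.
Qed.

(** For [i] in [W] this is the condition $c(W\setminus\{i\})<c(W)$: putting [i] back merges at least
    two components. *)
Definition cut_point W i := exists u v,
  [/\ u \notin W, v \notin W, e u i, e i v & ~~ connect (del_rel e W) u v].

(** Let [Q] be a prime between J_G and P_W. If [Q] missed a variable at some [i] in [W], the path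
    [u], [i], [v] would put $f_{uv}$ into [Q], hence into P_W, although [u] and [v] lie in different
    components. So [Q] contains the variables of [W], and then all of P_W. *)
Lemma cut_point_minimal W : (forall i, i \in W -> cut_point W i) ->
  is_minimal_prime_of (binomial_edge_ideal e) (@PW K n e W).
Proof.
move=> cutW; split; [exact: PW_prime|exact: edge_ideal_sub_PW|].
move=> Q Qp JQ QP; have Qi := idealr_like Qp.1.
have QW i : i \in W -> (x i \in Q) && (y i \in Q).
  move=> iW; apply: contraT => iQ.
  have [u [v [uW vW eui eiv /negP[]]]] := cutW i iW.
  rewrite -(@param_fbin_eq0 K) // -PW_ker //; apply: (QP).
  (* [T] lies inside [W] and misses [i], so the path through [i] avoids [T]. *)
  pose T := [set j | (x j \in Q) && (y j \in Q)].
  have inW j : j \notin W -> j \notin T.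
    move=> jW; rewrite inE; apply/negP => /andP[/QP + _].
    by rewrite PW_ker // param_x // (negPf jW) (negPf (xvar_neq0 _ _)).
  apply: (@prime_fbin_connect Q T) => //; [by move=> j; rewrite inE|exact: inW|].
  have iT : i \notin T by rewrite inE.
  by apply: (@connect_trans _ _ i); apply: connect1;
    rewrite /del_rel /= iT ?(inW u) ?(inW v).
apply: PW_sub => // [v /QW/andP[]//|u v uW vW cuv].
apply: (@prime_fbin_connect Q W) => // i iW; apply/negP => /andP[/QP + _].
by rewrite PW_ker // param_x // (negPf iW) (negPf (xvar_neq0 _ _)).
Qed.

(** Each visit of a path to [i] enters and leaves through a single component, as [i] is not a cut
    point. *)
Lemma not_cut_point_connect W i u v : i \in W -> ~ cut_point W i ->
    u \notin W -> v \notin W ->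
  connect (del_rel e (W :\ i)) u v -> connect (del_rel e W) u v.
Proof.
move=> iW ncut uW vW /connectP[p pp vE].
(* Invariant along the path: away from [i] the current vertex is reachable from [u] outside [W]; at
   [i] some neighbour of [i] is. *)
suff H z p' : path (del_rel e (W :\ i)) z p' ->
    (if z == i then exists w, [/\ w \notin W, e w i & connect (del_rel e W) u w]
     else z \notin W /\ connect (del_rel e W) u z) ->
    let t := last z p' in
    (if t == i then exists w, [/\ w \notin W, e w i & connect (del_rel e W) u w]
     else t \notin W /\ connect (del_rel e W) u t).
  have := H _ _ pp; rewrite /= -vE.
  have neq_i w : w \notin W -> (w == i) = false.
    by move=> wW; apply: contraNF wW => /eqP ->.
  by rewrite !neq_i //; case=> //; split=> //; apply: connect0.
elim: p' z {p pp vE} => //= w p IH z /andP[/and3P[zW wW ezw] pp] Hz.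
apply: IH pp _; move: zW wW ezw Hz; rewrite !inE !negb_and !negbK.
case: (eqVneq z i) => [->|_] /=; case: (eqVneq w i) => [->|_] //=.
- move=> _ wW eiw [t [tW eti cut]]; split=> //; apply: contra_notT ncut => cuw.
  by exists t, w; split=> //; apply: contra cuw; apply: connect_trans.
- by move=> zW _ ezi [_ cuz]; exists z.
- move=> zW wW ezw [_ cuz]; split=> //; apply: connect_trans cuz _.
  by apply: connect1; rewrite /del_rel /= zW wW.
Qed.

(** If [i] were not a cut point, restoring it would merge no components, and $P_{W\setminus\{i\}}$
    would be a prime between J_G and P_W without $x_i$. *)
Lemma minimal_cut_point W i : i \in W ->
    is_minimal_prime_of (binomial_edge_ideal e) (@PW K n e W) ->
  cut_point W i.
Proof.
move=> iW [_ _ minW]; case: (pselect (cut_point W i)) => // ncut.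
have := minW (@PW K n e (W :\ i)) (PW_prime K e_sym _)
  (@edge_ideal_sub_PW _).
have sub : {subset @PW K n e (W :\ i) <= @PW K n e W}.
  apply: PW_sub => //; first exact: idealr_like (@PW_closed K n e W).
    by move=> v /setD1P[_ vW]; apply: vars_in_PW.
  move=> u v uW vW cuv; rewrite PW_ker //.
  case: (boolP ((u \in W) || (v \in W))) => [|/norP[uW' vW']].
    rewrite /fbin rmorphB !rmorphM /= !param_x !param_y.
    by case/orP => ->; rewrite ?(mul0r, mulr0) subrr.
  by rewrite param_fbin_eq0 //; apply: not_cut_point_connect cuv.
move=> /(_ sub)/(_ (x i)); rewrite !PW_ker // !param_x !inE eqxx iW eqxx /=.
by rewrite (negPf (xvar_neq0 _ _)) => /(_ isT).
Qed.

Lemma cut_setP W : W != set0 ->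
  cut_set K e W <-> forall i, i \in W -> cut_point W i.
Proof.
move=> W0; split=> [[_ minW] i iW|cutW]; first exact: minimal_cut_point.
by split=> //; apply: cut_point_minimal.
Qed.

End CutSets.

(** * Algebraic independence along a chain of primes *)

Section AlgIndependence.
Local Open Scope ring_scope.

(* Discarding all exponents but those with the least k-th coordinate moves the
   relation from p k to p k.+1, as x k lies in p k.+1 but not in p k. *)
Lemma prime_chain_indep (R : comNzRingType) m (p : nat -> {pred R})
    (x : nat -> R) (T : finType) (E : T -> nat -> nat) (v : T -> R)
    (A : {set T}) :
    prime_chain m p -> (forall i, (i < m)%N -> x i \in p i.+1 /\ x i \notin p i) ->
    A != set0 ->
    {in A &, forall s t, (forall i, (i < m)%N -> E s i = E t i) -> s = t} ->
    \sum_(t in A) v t * \prod_(0 <= i < m) x i ^+ E t i \in p 0%N ->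
  exists2 t, t \in A & v t \in p m.
Proof.
move=> [pprime psub] xP A0 Einj sum0.
have pD i (a b : R) : (i <= m)%N -> a \in p i -> b \in p i -> a + b \in p i.
  by move=> /pprime[[_ _ pM] _] ap bp; rewrite -[a]mul1r pM.
have pM i (a b : R) : (i <= m)%N -> b \in p i -> a * b \in p i.
  by move=> /pprime[[p0 _ pM] _] bp; rewrite -[_ * _]addr0 pM.
(* After [k] rounds the surviving terms agree in their first [k] exponents and these factors are
   divided out; after [m] rounds injectivity leaves one term. *)
suff H k : (k <= m)%N -> exists B : {set T}, [/\ B != set0, B \subset A,
    {in B &, forall s t, forall i, (i < k)%N -> E s i = E t i} &
    \sum_(t in B) v t * \prod_(k <= i < m) x i ^+ E t i \in p k].
  have [B [/set0Pn[t tB] /subsetP BA Eeq]] := H m (leqnn m).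
  rewrite (big_setD1 t) //= big_geq // mulr1 [X in _ + X]big1 ?addr0 => [|s].
    by exists t => //; apply: BA.
  rewrite !inE => /andP[/eqP st sB]; case: st; apply: Einj; [exact: BA..|].
  by move=> i im; apply: Eeq.
elim: k => [_|k IH km]; first by exists A; split.
have [B [/set0Pn[t0 t0B] /subsetP BA Eeq sumB]] := IH (ltnW km).
have [xS xN] := xP k km.
pose t1 := [arg min_(t < t0 in B) E t k].
have [t1B t1min] : t1 \in B /\ forall t, t \in B -> (E t1 k <= E t k)%N.
  by rewrite /t1; case: arg_minnP.
pose a := E t1 k.
exists [set t in B | E t k == a]; split.
- by apply/set0Pn; exists t1; rewrite !inE t1B eqxx.
- by apply/subsetP => t; rewrite inE => /andP[/BA].
- move=> s t; rewrite !inE => /andP[sB /eqP sa] /andP[tB /eqP ta] i.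
  by rewrite ltnS leq_eqVlt => /predU1P[->|ik]; [rewrite sa ta|apply: Eeq].
have inP : \sum_(t in B) v t * x k ^+ (E t k - a) *
    \prod_(k.+1 <= i < m) x i ^+ E t i \in p k.
  (* Primality allows division by [x k ^+ a], as no power of [x k] lies in [p k]. *)
  have : x k ^+ a * (\sum_(t in B) v t * x k ^+ (E t k - a) *
      \prod_(k.+1 <= i < m) x i ^+ E t i) \in p k.
    rewrite (_ : _ * _ = \sum_(t in B) v t * \prod_(k <= i < m) x i ^+ E t i) //.
    rewrite big_distrr; apply: eq_bigr => t tB /=.
    rewrite [in RHS]big_ltn // -{2}(subnK (t1min t tB)) exprD -/a.
    by rewrite (mulrC (x k ^+ a)) -!mulrA; congr (_ * (_ * _)); apply: mulrC.
  case: (pprime k (ltnW km)) => _ pk /pk/orP[|//].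
  suff /negPf -> : x k ^+ a \notin p k by [].
  elim: (a) => [|b IHb]; first by rewrite expr0; case: (pprime k (ltnW km)) => [[]].
  by rewrite exprS; apply: contra IHb => /pk/orP[|//]; rewrite (negPf xN).
have := (psub k km).1 _ inP; rewrite (bigID (fun t => E t k == a)) /=.
set s1 := \sum_(_ in _ | _) _; set s2 := \sum_(_ in _ | _) _ => sumS.
(* Terms with a larger exponent keep a factor [x k], which lies in [p k.+1]. *)
have s2P : s2 \in p k.+1.
  rewrite /s2; apply: (big_ind (fun f => f \in p k.+1)).
  - by case: (pprime k.+1 km) => [[]].
  - by move=> f g; apply: pD.
  move=> t /andP[tB ta]; rewrite mulrAC; apply: (pM) => //.
  have : (0 < E t k - a)%N by rewrite subn_gt0 ltn_neqAle eq_sym ta t1min.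
  by case: (E t k - a)%N => // d _; rewrite exprSr; apply: (pM).
rewrite (_ : \sum_(_ in _) _ = s1); last first.
  rewrite /s1; apply: eq_big => [t|t]; rewrite inE // => /andP[_ /eqP ->].
  by rewrite subnn mulr1.
have -> : s1 = s1 + s2 + -1 * s2 by rewrite mulN1r addrK.
by apply: (pD) => //; apply: (pM).
Qed.

End AlgIndependence.

(** * Algebraic dependence of more polynomials than variables *)

Section AlgDependence.
Local Open Scope ring_scope.
Variables (K : fieldType) (N : nat) (Z : {set 'I_N}).
Local Notation S := {mpoly K[N]}.

Definition supported_on (p : S) :=
  forall mu, mu \in msupp p -> forall j, j \notin Z -> mu j = 0%N.

Definition bounded_by d (p : S) :=
  supported_on p /\ forall mu, mu \in msupp p -> (mdeg mu <= d)%N.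

Lemma bounded_byM d d' p q :
  bounded_by d p -> bounded_by d' q -> bounded_by (d + d') (p * q).
Proof.
move=> [p1 p2] [q1 q2]; split=> mu /msuppM_le/allpairsP[[m1 m2] /= [m1p m2q ->]].
  by move=> j jZ; rewrite mnmDE (p1 _ m1p) // (q1 _ m2q).
by rewrite mdegD leq_add ?p2 ?q2.
Qed.

Lemma bounded_by1 : bounded_by 0 1.
Proof. by split=> mu; rewrite msupp1 inE => /eqP ->; rewrite ?mdeg0 // => j; rewrite mnm0E. Qed.

Lemma bounded_byX d p k : bounded_by d p -> bounded_by (k * d) (p ^+ k).
Proof.
move=> pd; elim: k => [|k IH]; first exact: bounded_by1.
by rewrite exprS mulSn; apply: bounded_byM.
Qed.

Lemma supported_onM p q : supported_on p -> supported_on q -> supported_on (p * q).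
Proof.
move=> p1 q1 mu /msuppM_le/allpairsP[[m1 m2] /= [m1p m2q ->]] j jZ.
by rewrite mnmDE (p1 _ m1p) // (q1 _ m2q).
Qed.

Lemma supported_onD p q : supported_on p -> supported_on q -> supported_on (p + q).
Proof. by move=> p1 q1 mu /msuppD_le; rewrite mem_cat => /orP[/p1|/q1]. Qed.

Lemma supported_onC c : supported_on c%:MP.
Proof.
move=> mu; rewrite msuppC; case: eqP => // _; rewrite inE => /eqP -> j _.
by rewrite mnm0E.
Qed.

Lemma supported_onU j : j \in Z -> supported_on 'X_j.
Proof.
move=> jZ mu; rewrite msuppX inE => /eqP -> i iZ; rewrite mnm1E.
by case: eqP => // ij; rewrite -ij jZ in iZ.
Qed.

Lemma supported_on_mmap n (h : 'I_n -> S) p :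
  (forall i, supported_on (h i)) -> supported_on (mmap (@mpolyC _ K) h p).
Proof.
move=> hZ; rewrite /mmap; apply: (big_ind supported_on).
- by rewrite -mpolyC0; apply: supported_onC.
- exact: supported_onD.
move=> mu _; apply: supported_onM; first exact: supported_onC.
have Z1 : supported_on 1 by rewrite -mpolyC1; apply: supported_onC.
rewrite /mmap1; apply: (big_ind supported_on) => // [|i _]; first exact: supported_onM.
elim: (mu i) => [//|k IH]; rewrite exprS; exact: supported_onM.
Qed.

(* Counting: the M^m products of powers lie in a space of dimension at most
   (m * d * M + 1)^|Z|, which is smaller for large M when |Z| < m. *)
Lemma alg_dependent m (g : 'I_m -> S) :
    (#|Z| < m)%N -> (forall i, supported_on (g i)) ->
  exists M (v : {ffun 'I_m -> 'I_M} -> K),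
    (exists t, v t != 0) /\
    \sum_t v t *: \prod_i g i ^+ t i = 0.
Proof.
move=> ltZm gZ.
pose d := (\max_i msize (g i))%N.
have gd i : bounded_by d (g i).
  split=> // mu /msize_mdeg_lt/ltnW/leq_trans; apply.
  exact: (leq_bigmax_cond (F := fun i => msize (g i))).
(* This [M] gives [((m * d).+1 * M) ^ #|Z| < M ^ #|Z|.+1 <= M ^ m]. *)
pose M := ((m * d).+1 ^ #|Z|).+1; exists M.
pose G (t : {ffun 'I_m -> 'I_M}) := \prod_i g i ^+ t i.
pose B := (m * (M * d))%N.
have GB t : bounded_by B (G t).
  have : bounded_by (\sum_i t i * d) (G t).
    rewrite /G; apply: (big_ind2 (fun p d => bounded_by d p)).
    - exact: bounded_by1.
    - by move=> p a q b; apply: bounded_byM.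
    - by move=> i _; apply: bounded_byX.
  case=> s1 s2; split=> // mu /s2/leq_trans; apply.
  rewrite /B -[m in X in (_ <= X)%N]card_ord -sum_nat_const leq_sum // => i _.
  by rewrite leq_mul2r ltnW ?orbT.
(* A box of exponents that contains all those occurring in some [G t]. *)
pose U := pffun_on (ord0 : 'I_B.+1) Z predT.
have cardU : #|U| = (B.+1 ^ #|Z|)%N by rewrite card_pffun_on card_ord.
have cardT : #|{ffun 'I_m -> 'I_M}| = (M ^ m)%N by rewrite card_ffun !card_ord.
have lt_card : (#|U| < #|{ffun 'I_m -> 'I_M}|)%N.
  rewrite cardU cardT.
  have leB : (B.+1 <= (m * d).+1 * M)%N by rewrite /B; nia.
  have le_exp : (B.+1 ^ #|Z| <= ((m * d).+1 * M) ^ #|Z|)%N.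
    by case: #|Z| => // z; rewrite leq_exp2r.
  apply: leq_ltn_trans le_exp _; rewrite expnMn.
  apply: (@leq_trans (M ^ #|Z|.+1)); last by rewrite leq_exp2l // ltnS expn_gt0.
  by rewrite expnS ltn_pmul2r ?expn_gt0 // ltnSn.
pose A : 'M[K]_(#|{ffun 'I_m -> 'I_M}|, #|U|) :=
  \matrix_(i, j) (G (enum_val i))@_[multinom
    ((enum_val j : {ffun 'I_N -> 'I_B.+1}) k : nat) | k < N].
have : kermx A != 0.
  rewrite kermx_eq0 /row_free; apply/eqP => rkA.
  by have := rank_leq_col A; rewrite rkA leqNgt lt_card.
case/rowV0Pn => w /sub_kermxP wA w0.
exists (fun t => w 0 (enum_rank t)); split.
  have [j wj] : exists j, w 0 j != 0.
    by apply/existsP; apply: contraR w0; rewrite negb_exists => /forallP H;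
      apply/eqP/rowP => j; rewrite mxE; apply/eqP; rewrite -[_ == _]negbK H.
  by exists (enum_val j); rewrite enum_valK.
apply/mpolyP => mu; rewrite mcoeff0 raddf_sum /=.
case: (pselect ((forall j, j \notin Z -> mu j = 0%N) /\ (mdeg mu <= B)%N)).
  move=> [muZ muB].
  have lemu k : (mu k < B.+1)%N.
    by rewrite ltnS (leq_trans _ muB) // mdegE (bigD1 k) //= leq_addr.
  pose f := [ffun k => Ordinal (lemu k)].
  have fU : f \in U.
    apply/pffun_onP; split=> [|//]; apply/supportP => k kZ.
    by rewrite ffunE; apply/val_inj; rewrite /= muZ.
  have := congr1 (fun X : 'rV_(#|U|) => X 0 (enum_rank_in fU f)) wA.
  rewrite !mxE => {2}<-.
  rewrite (reindex (fun i : 'I_#|{ffun 'I_m -> 'I_M}| => enum_val i)) /=; last first.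
    by apply: onW_bij; apply: enum_val_bij.
  apply: eq_bigr => i _; rewrite enum_valK mcoeffZ mxE; congr (_ * _@_ _).
  by apply/mnmP => k; rewrite mnmE enum_rankK_in // ffunE.
move=> nmu; rewrite big1 // => t _; rewrite mcoeffZ; apply/eqP; rewrite mulf_eq0.
apply/orP; right; rewrite mcoeff_eq0; apply: contra_notN nmu => /= muG.
by split; [apply: (GB t).1|apply: (GB t).2].
Qed.

End AlgDependence.

(** * The Krull dimension of S / P_W *)

Section KrullDim.
Local Open Scope ring_scope.
Local Open Scope quotient_scope.
Variables (K : fieldType) (n : nat) (e : rel 'I_n).
Hypothesis e_sym : symmetric e.
Variable W : {set 'I_n}.
Local Notation S := {mpoly K[n + n]}.
Local Notation x := (@xvar K n).
Local Notation y := (@yvar K n).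
Local Notation PWS := (@PW K n e W).
Local Notation A := (quotPW K e W).
Local Notation pi := (\pi_{ideal_quot (PWS : idealr _)} : S -> A).

Lemma pi_eq0 f : (pi f == 0) = (f \in PWS).
Proof.
have := @Quotient.idealrBE _ (PWS : idealr _) f 0; rewrite subr0 => ->.
by rewrite -(rmorph0 (\pi_{ideal_quot (PWS : idealr _)})).
Qed.

Lemma pi_preim_prime (P : {pred A}) :
  is_prime_ideal P -> is_prime_ideal [pred f | pi f \in P].
Proof.
move=> [[P0 P1 PM] Pp]; split; first split.
- by rewrite inE rmorph0.
- by rewrite inE rmorph1.
- by move=> a u v; rewrite !inE rmorphD rmorphM; apply: PM.
by move=> u v; rewrite !inE rmorphM; apply: Pp.
Qed.

(** Lets maps on the quotient be computed on chosen representatives, which differ from [p] by an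
    element of P_W. *)
Lemma repr_pi_morph (f : {rmorphism S -> S}) p :
  {in PWS, forall q, f q = 0} -> f (repr (pi p)) = f p.
Proof.
move=> f0; apply/eqP; rewrite -subr_eq0 -rmorphB f0 // -pi_eq0 rmorphB /= reprK.
by rewrite subrr.
Qed.

Lemma repr_ker_prime (f : {rmorphism S -> S}) : {in PWS, forall q, f q = 0} ->
  is_prime_ideal [pred a : A | f (repr a) == 0].
Proof.
move=> f0; have fE := fun p => repr_pi_morph p f0.
split; first split.
- by rewrite inE -(rmorph0 (\pi_{ideal_quot (PWS : idealr _)})) fE rmorph0.
- by rewrite inE -(rmorph1 (\pi_{ideal_quot (PWS : idealr _)})) fE rmorph1 oner_eq0.
- move=> a u v; rewrite !inE -[a]reprK -[u]reprK -[v]reprK -rmorphM -rmorphD !fE.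
  by rewrite rmorphD rmorphM => /eqP -> /eqP ->; rewrite mulr0 addr0.
move=> u v; rewrite !inE -[u]reprK -[v]reprK -rmorphM !fE.
by rewrite rmorphM mulf_eq0.
Qed.

(** * A chain of primes obtained by killing variables *)

Definition kill_var (Z : {set 'I_(n + n)}) k : S := if k \in Z then 'X_k else 0.
Definition kill Z : S -> S := mmap (@mpolyC _ K) (kill_var Z).
HB.instance Definition _ Z := GRing.RMorphism.on (kill Z).

Lemma killX Z k : kill Z 'X_k = if k \in Z then 'X_k else 0.
Proof. by rewrite /kill mmapX mmap1U. Qed.

Lemma kill_kill (Z Z' : {set 'I_(n + n)}) p : Z' \subset Z ->
  kill Z' (kill Z p) = kill Z' p.
Proof.
move=> /subsetP ZZ; rewrite [kill Z p]/kill [RHS]/kill /mmap rmorph_sum.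
apply: eq_bigr => mu _.
rewrite rmorphM /= {1}/kill mmapC; congr (_ * _).
rewrite /mmap1 rmorph_prod; apply: eq_bigr => k _; rewrite rmorphXn /=.
congr (_ ^+ _); rewrite /kill_var; case: ifPn => [_|kZ]; first exact: killX.
by rewrite rmorph0 ifN //; apply: contra kZ; apply: ZZ.
Qed.

Let reps := [set comp_root e W v | v in ~: W].

Let dim := (#|~: W| + #|reps|)%N.

Lemma reps_out w : w \in reps -> w \notin W /\ comp_root e W w = w.
Proof.
case/imsetP => v; rewrite inE => vW ->; split; first exact: comp_rootN.
by apply/eqP; rewrite comp_root_eq // (del_rel_sym e_sym) connect_root.
Qed.

(** The order matters: $y_w$ enters the image of [param] only multiplied by x-variables of its
    component, so $x_w$ must outlive $y_w$ for the killing of $y_w$ to enlarge the kernel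
    visibly. *)
Definition kept_vars : seq 'I_(n + n) :=
  [seq lshift n v | v <- enum (~: W :\: reps)] ++
  [seq rshift n w | w <- enum reps] ++ [seq lshift n w | w <- enum reps].

Lemma size_kept_vars : size kept_vars = dim.
Proof.
rewrite !size_cat !size_map -!cardE cardsD (setIidPr _).
  have : (#|reps| <= #|~: W|)%N by apply: leq_imset_card.
  by rewrite /dim addnA => /subnK ->.
by apply/subsetP => w /reps_out[wW _]; rewrite inE.
Qed.

Lemma uniq_kept_vars : uniq kept_vars.
Proof.
rewrite !cat_uniq !map_inj_uniq ?enum_uniq ?andbT /=; try exact: lshift_inj;
  try exact: rshift_inj.
apply/andP; split; apply/hasPn => z; rewrite ?mem_cat.
  case/orP => /mapP[w wR ->]; apply/mapP => -[v vR /eqP].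
    by rewrite eq_rlshift.
  rewrite (inj_eq (@lshift_inj _ _)) => /eqP wv.
  by move: wR vR; rewrite wv !mem_enum inE => ->.
by case/mapP => w _ ->; apply/mapP => -[v _ /eqP]; rewrite eq_lrshift.
Qed.

Let kept k : {set 'I_(n + n)} := [set z in drop k kept_vars].
Let chain_map k : S -> S := kill (kept k) \o @param K n e W.
HB.instance Definition _ k := GRing.RMorphism.on (chain_map k).

Lemma chain_map_PW k : {in PWS, forall q, chain_map k q = 0}.
Proof. by move=> q; rewrite PW_ker // /chain_map /= => /eqP ->; rewrite rmorph0. Qed.

(** The list has no repetition, so a killed variable does not come back. Taking [z] as its own
    default in [nth] avoids fixing an element of ['I_(n + n)]. *)
Lemma keptS k : (k < dim)%N -> exists z, [/\ z = nth z kept_vars k,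
  z \in kept k, z \notin kept k.+1 & kept k.+1 \subset kept k].
Proof.
rewrite -size_kept_vars => ks.
have [z0 _] : {z0 | z0 \in kept_vars}.
  by case: (kept_vars) ks => // z0 s _; exists z0; apply: mem_head.
pose z := nth z0 kept_vars k.
have dE : drop k kept_vars = z :: drop k.+1 kept_vars by apply: drop_nth.
have := drop_uniq k uniq_kept_vars; rewrite dE /= => /andP[zN _].
exists z; split; rewrite ?inE ?dE ?mem_head //; first exact: set_nth_default.
by apply/subsetP => t; rewrite !inE dE inE orbC => ->.
Qed.

(** If the next variable killed is some $x_v$, it is its own image; if it is some $y_w$, the image
    of $y_w$ is $x_w y_w$ with $x_w$ still kept. *)
Lemma chain_map_strict k : (k < dim)%N -> exists2 p, chain_map k.+1 p = 0 &
  chain_map k p != 0.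
Proof.
move=> ks; have [z [zE zk zk' _]] := keptS ks.
have xcase v : v \notin W -> z = lshift n v -> exists2 p, chain_map k.+1 p = 0 &
    chain_map k p != 0.
  move=> vW zv; exists (x v); rewrite /chain_map /= param_x (negPf vW) killX -zv.
    by rewrite (negPf zk').
  by rewrite zk zv xvar_neq0.
move: zE; rewrite /kept_vars nth_cat size_map -cardE; case: ltnP => k1.
  move=> zE; have : z \in [seq lshift n v | v <- enum (~: W :\: reps)].
    by rewrite zE mem_nth // size_map -cardE.
  by case/mapP => v; rewrite mem_enum !inE => /andP[_ vW]; apply: xcase.
rewrite nth_cat size_map -cardE; case: ltnP => k2 zE; last first.
  have : z \in [seq lshift n w | w <- enum reps].
    rewrite zE mem_nth // size_map -cardE.
    have := ks; rewrite -size_kept_vars !size_cat !size_map -!cardE.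
    by move: k1 k2; set a := #|_|; set b := #|_|; lia.
  by case/mapP => w; rewrite mem_enum => /reps_out[wW _]; apply: xcase.
have : z \in [seq rshift n w | w <- enum reps].
  by rewrite zE mem_nth // size_map -cardE.
case/mapP => w; rewrite mem_enum => wR zw; have [wW wE] := reps_out wR.
have xk : lshift n w \in kept k.
  rewrite inE /kept_vars drop_cat size_map -cardE ltnNge k1 /=.
  rewrite drop_cat size_map -cardE k2 mem_cat; apply/orP; right.
  by apply: map_f; rewrite mem_enum.
exists (y w); rewrite /chain_map /= param_y (negPf wW) wE rmorphM /= !killX -zw.
  by rewrite (negPf zk') mulr0.
by rewrite zk xk zw mulf_neq0 ?xvar_neq0 ?yvar_neq0.
Qed.

Lemma quotPW_chain : exists p : nat -> {pred A}, prime_chain dim p.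
Proof.
exists (fun k => pred_of_simpl [pred a : A | chain_map k (repr a) == 0]); split.
  by move=> k _; apply: repr_ker_prime; apply: chain_map_PW.
move=> k kd; split=> [a|].
  have [z [_ _ _ sub]] := keptS kd.
  move=> /eqP/= a0; apply/eqP; rewrite /= /chain_map /= -(kill_kill _ sub).
  by rewrite [kill (kept k) _]a0 rmorph0.
have [p p0 /negP pN] := chain_map_strict kd.
have reprE j : chain_map j (repr (pi p)) = chain_map j p.
  exact: repr_pi_morph (@chain_map_PW j).
move=> sub; apply: pN; rewrite -reprE; apply: (sub (pi p)).
by apply/eqP; rewrite /= reprE.
Qed.

(** Elements picked from the successive differences of the chain, pulled back to [S], have images in
    at most [dim] variables. In a longer chain these images are dependent; the relation lies in P_W,
    hence in the smallest prime, and this forces a nonzero constant into the largest one. *)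
Lemma quotPW_chain_le m (p : nat -> {pred A}) : prime_chain m p -> (m <= dim)%N.
Proof.
move=> [pprime psub]; rewrite leqNgt; apply/negP => ltm.
pose P k : {pred S} := [pred f | pi f \in p k].
have Pchain : prime_chain m P.
  split=> [i im|i im]; first exact: pi_preim_prime (pprime i im).
  have [s1 s2] := psub i im; split=> [f|H]; first by rewrite !inE; apply: s1.
  by apply: s2 => a; have := H (repr a); rewrite !inE reprK.
have /choice[g gP] i : exists f, (i < m)%N -> f \in P i.+1 /\ f \notin P i.
  case: (pselect (i < m)%N) => [im|]; last by exists 0.
  have [_ /existsNP[f /not_implyP[f1 /negP f2]]] := Pchain.2 i im.
  by exists f.
pose Z := [set lshift n v | v in ~: W] :|: [set rshift n w | w in reps].
have ltZ : (#|Z| < m)%N.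
  apply: leq_ltn_trans ltm; apply: leq_trans (leq_card_setU _ _) _.
  by apply: leq_add; apply: leq_imset_card.
have paramZ f : supported_on Z (@param K n e W f).
  apply: supported_on_mmap => k; rewrite /param_var.
  have s0 : supported_on Z (0 : S) by rewrite -mpolyC0; apply: supported_onC.
  case: (split k) => v; case: ifPn => // vW.
    by apply: supported_onU; rewrite inE imset_f // inE.
  have vW' : v \in ~: W by rewrite inE.
  apply: supported_onM; apply: supported_onU; rewrite inE; apply/orP.
    by left; apply: imset_f.
  by right; apply/imset_f/imset_f.
have gZ (i : 'I_m) : supported_on Z (@param K n e W (g i)) by apply: paramZ.
have [M [c [[t0 ct0] sum0]]] := alg_dependent ltZ gZ.
pose E (t : {ffun 'I_m -> 'I_M}) (i : nat) : nat :=
  if insub i is Some j then t j : nat else 0%N.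
have EE t (i : 'I_m) : E t i = t i by rewrite /E valK.
have [||||t] := @prime_chain_indep S m P g _ E (fun t => (c t)%:MP)
  [set t | c t != 0] Pchain.
- exact: gP.
- by apply/set0Pn; exists t0; rewrite inE.
- move=> s t _ _ H; apply/ffunP => i; apply: val_inj.
  by rewrite /= -!EE; apply: H.
- suff /eqP E0 : pi (\sum_(t in [set t | c t != 0]) (c t)%:MP *
      \prod_(0 <= i < m) g i ^+ E t i) == 0.
    by rewrite inE E0; case: (pprime 0%N (leq0n m)) => [[]].
  rewrite pi_eq0 PW_ker //; apply/eqP; rewrite rmorph_sum /= -[RHS]sum0.
  rewrite big_mkcond /=.
  apply: eq_bigr => t _; rewrite inE; case: eqP => [->|_] /=.
    by rewrite scale0r.
  rewrite rmorphM /= {1}/param mmapC mul_mpolyC; congr (_ *: _).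
  rewrite big_mkord rmorph_prod; apply: eq_bigr => i _.
  by rewrite rmorphXn EE.
rewrite inE => ct cP; case: (Pchain.1 m (leqnn m)) => [[P0 /negP P1 PM] _]; apply: P1.
have := PM ((c t)^-1)%:MP _ _ cP P0.
by rewrite addr0 -mpolyCM mulVf // mpolyC1.
Qed.

Lemma quotPW_krull_dim : has_krull_dim A dim.
Proof. by split; [exact: quotPW_chain|exact: quotPW_chain_le]. Qed.

End KrullDim.

(** * Closed graphs *)

Lemma count_leq_nth (s : seq nat) i : sorted ltn s -> i < size s ->
  count (fun c => c <= nth 0 s i) s = i.+1.
Proof.
elim: s i => // c s IH i /= sc; have := order_path_min ltn_trans sc.
move=> /allP cmin; case: i => [|i] /= si.
  rewrite leqnn (eq_in_count (a2 := pred0)) ?count_pred0 // => d /cmin.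
  by rewrite /= ltnNge => /negPf.
by rewrite IH ?(path_sorted sc) // ltnW // cmin // mem_nth.
Qed.

(** Turns equal values of [comp_index] into agreement on every single run. *)
Lemma count_eq_in (T : eqType) (p q : pred T) (s : seq T) :
  {in s, subpred p q} -> count p s = count q s -> {in s, p =1 q}.
Proof.
elim: s => // c s IH pq /= Ecount.
have pqs : {in s, subpred p q} by move=> d ds; apply: pq; rewrite inE ds orbT.
have le_s : count p s <= count q s.
  rewrite (eq_in_count (a2 := predI p q)) => [|d /pqs /=]; last first.
    by case: (p d) => // ->.
  by apply: sub_count => d /andP[].
have pqc : p c -> q c by apply: pq; rewrite mem_head.
have Ec : p c = q c.
  move: pqc Ecount le_s; case: (p c); case: (q c) => //=; first by move=> /(_ isT).
  by move=> _; rewrite add0n add1n => ->; rewrite ltnn.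
move=> d; rewrite inE => /predU1P[-> //|]; apply: IH => //.
by apply/eqP; rewrite -(eqn_add2l (p c)) {2}Ec Ecount.
Qed.

Lemma sum_seq_eq_size (T : eqType) (f : T -> nat) (s : seq T) :
  {in s, forall t, 0 < f t} ->
  size s <= \sum_(t <- s) f t /\
  (\sum_(t <- s) f t = size s <-> forall t, t \in s -> f t = 1).
Proof.
elim: s => [|c s IH] fpos; first by rewrite big_nil.
have [ds|le_s [eq1 eq2]] := IH; first by move=> ds'; apply: fpos; rewrite inE ds' orbT.
have fc : 0 < f c by apply: fpos; rewrite mem_head.
rewrite big_cons /=; split; first by lia.
split=> [E t|H].
  by rewrite inE => /predU1P[->|]; [lia|apply: eq1; lia].
rewrite H ?mem_head // eq2 // => t ts; apply: H; by rewrite inE ts orbT.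
Qed.

(** * Facets, edges and intersections of consecutive facets *)

Section ClosedGraphs.
Variables (n : nat) (e : rel 'I_n) (r : nat) (a b : nat -> nat).
Hypothesis e_sym : symmetric e.
Hypothesis e_conn : connected_graph e.
Hypothesis e_closed : closed_with_facets e r a b.
Implicit Types (u v w : 'I_n) (W F : {set 'I_n}).

Local Notation itv := (vertex_itv n).

Lemma vertex_of_label k : 1 <= k <= n -> exists v : 'I_n, v.+1 = k.
Proof. by case: k => // k /= kn; exists (Ordinal kn). Qed.

Lemma facet_starts_lt i j : 1 <= i -> i < j -> j <= r -> a i < a j.
Proof.
case: e_closed => _ [_ _ amono _ _] i1; elim: j => // j IH.
rewrite ltnS leq_eqVlt => /predU1P[<-|ij] jr; first by apply: amono; rewrite i1.
by apply: ltn_trans (IH ij (ltnW jr)) (amono _ _); rewrite jr (leq_trans i1 (ltnW ij)).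
Qed.

Lemma facet_starts_ge1 i : 1 <= i <= r -> 1 <= a i.
Proof.
case: e_closed => _ [_ a1 _ _ _] /andP[]; rewrite leq_eqVlt => /predU1P[<-|i1 ir].
  by rewrite a1.
by have := facet_starts_lt (leqnn 1) i1 ir; rewrite a1 => /ltnW.
Qed.

Lemma graph_nonempty : 0 < n.
Proof. by case: e_closed => _ [_ _ _ abr <-]; apply: leq_trans abr. Qed.

Lemma facet_itv i : 1 <= i <= r -> maxset (clique e) (itv (a i) (b i)).
Proof. by move=> ir; apply/e_closed.1; exists i. Qed.

Lemma facet_nonempty i : 1 <= i <= r -> a i <= b i /\ a i <= n.
Proof.
move=> ir; have [v0 _] := vertex_of_label (k := 1) graph_nonempty.
have cl : clique e [set v0].
  apply/forall_inP => u /set1P ->; apply/forall_inP => v /set1P ->.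
  by rewrite eqxx.
case: (set_0Vmem (itv (a i) (b i))) => [F0|[v]]; last first.
  rewrite inE => /andP[av vb].
  by split; [apply: leq_trans vb|apply: leq_trans (ltn_ord v)].
have := maxsetsup (facet_itv ir) cl; rewrite F0 sub0set.
by move=> /(_ isT)/setP/(_ v0); rewrite !inE eqxx.
Qed.

(** Otherwise $F_j\subseteq F_i$, and maximality makes them equal, although $a_i$ belongs to $F_i$
    only. *)
Lemma facet_ends_lt i j : 1 <= i -> i < j -> j <= r -> b i < b j.
Proof.
move=> i1 ij jr; rewrite ltnNge; apply/negP => bji.
have ir : 1 <= i <= r by rewrite i1 (leq_trans (ltnW ij) jr).
have jr' : 1 <= j <= r by rewrite jr (leq_trans i1 (ltnW ij)).
have aij := facet_starts_lt i1 ij jr.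
have /maxsetp Fi := facet_itv ir.
have := maxsetsup (facet_itv jr') Fi.
have sub : itv (a j) (b j) \subset itv (a i) (b i).
  by apply/subsetP => v; rewrite !inE; lia.
move=> /(_ sub)/setP E; have [ab an] := facet_nonempty ir.
have [|v vE] := @vertex_of_label (a i); first by rewrite an facet_starts_ge1.
by have := E v; rewrite !inE vE leqnn ab leqNgt aij.
Qed.

Lemma facet_ends_le i : 1 <= i <= r -> b i <= n.
Proof.
case: e_closed => _ [_ _ _ _ <-] /andP[i1].
rewrite leq_eqVlt => /predU1P[-> //|ir]; apply: ltnW.
by apply: facet_ends_lt.
Qed.

Lemma edge_facetP u v : u < v ->
  reflect (exists2 i, 1 <= i <= r & a i <= u.+1 /\ v.+1 <= b i) (e u v).
Proof.
move=> uv; apply: (iffP idP) => [euv|[i ir [au vb]]]; last first.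
  have /maxsetp/forall_inP/(_ u) := facet_itv ir.
  rewrite !inE au (leq_trans _ vb) ?ltnS ?(ltnW uv) // => /(_ isT)/forall_inP/(_ v).
  rewrite inE vb (leq_trans au) ?ltnS ?(ltnW uv) // => /(_ isT)/implyP; apply.
  by apply: contraTneq uv => ->; rewrite ltnn.
have cl : clique e [set u; v].
  apply/forall_inP => x /set2P xE; apply/forall_inP => y /set2P yE.
  by case: xE yE => -> [] ->; rewrite ?eqxx // ?(e_sym v u) euv implybT.
have [F /e_closed.1[i ir ->] /subsetP sub] := maxset_exists cl.
exists i => //; have := sub u (set21 _ _); have := sub v (set22 _ _).
by rewrite !inE => /andP[_ ->] /andP[-> _].
Qed.

(** An edge across a gap would need a facet straddling it; without one, the vertices up to [b i] are
    closed under adjacency, against connectedness. *)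
Lemma facets_overlap i : 1 <= i < r -> a i.+1 <= b i.
Proof.
case/andP=> i1 ir; rewrite leqNgt; apply/negP => gap.
have ir' : 1 <= i <= r by rewrite i1 ltnW.
have [ab an] := facet_nonempty ir'.
have [|v vE] := @vertex_of_label (a i); first by rewrite an facet_starts_ge1.
have bn : b i < n.
  by apply: leq_trans (facet_ends_lt i1 (ltnSn i) ir) (facet_ends_le _).
have [|w wE] := @vertex_of_label (b i).+1; first exact: bn.
have cl : closed e [pred z : 'I_n | z.+1 <= b i].
  have half (z t : 'I_n) : z < t -> e z t -> (z.+1 <= b i) = (t.+1 <= b i).
    move=> zt /(edge_facetP zt)[k /andP[k1 kr] [az tb]].
    case: (ltngtP k i) => [ki|ki|ki]; last by subst k; lia.
      by have := facet_ends_lt k1 ki (ltnW ir); lia.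
    suff : a i.+1 <= a k by lia.
    move: ki; rewrite leq_eqVlt => /predU1P[<- //|ki].
    by apply: ltnW; apply: facet_starts_lt.
  move=> z t ezt; rewrite !inE; case: (ltngtP z t) => [zt|tz|/val_inj -> //].
    exact: half.
  by apply/esym/half; rewrite // e_sym.
have := closed_connect cl (e_conn v w); rewrite !inE vE wE ab ltnn.
by [].
Qed.

Lemma edge_succ u v : v = u.+1 :> nat -> e u v.
Proof.
move=> uv; apply/edge_facetP; first by rewrite uv.
have [_ [r1 a1 _ _ brn]] := e_closed.
have ex : exists i, (1 <= i <= r) && (v.+1 <= b i).
  by exists r; rewrite r1 leqnn brn ltn_ord.
(* The first facet reaching [v] contains [u]: it starts at 1, or it overlaps its predecessor, which
   ends at [u] at the latest. *)
case: (ex_minnP ex) => i /andP[ir vb] imin; exists i => //; split=> //.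
case: i ir vb imin => // -[|i] ir vb imin; first by rewrite a1.
have ir' : 1 <= i.+1 < r by move: ir; lia.
apply: leq_trans (facets_overlap ir') _; rewrite leqNgt; apply/negP => ub.
by have := imin i.+1; rewrite uv ub (_ : 1 <= i.+1 <= r) //; [move=> /(_ isT); rewrite ltnn|lia].
Qed.

Lemma conn_cutE i : 1 <= i < r -> conn_cut n a b i = itv (a i.+1) (b i).
Proof.
case/andP=> i1 ir; apply/setP => v; rewrite !inE.
have := facet_starts_lt i1 (ltnSn i) ir; have := facet_ends_lt i1 (ltnSn i) ir.
by lia.
Qed.

Lemma set_max_conn_cut i : 1 <= i < r -> set_max (conn_cut n a b i) = b i.
Proof.
move=> ir; have abi := facets_overlap ir.
have bn : b i <= n by apply: facet_ends_le; lia.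
have a1 : 1 <= a i.+1 by apply: facet_starts_ge1; lia.
rewrite /set_max conn_cutE //; apply/eqP; rewrite eqn_leq; apply/andP; split.
  by apply/bigmax_leqP => v; rewrite inE => /andP[].
have [|v vE] := @vertex_of_label (b i); first by rewrite bn andbT; lia.
rewrite -{1}vE; apply: (leq_bigmax_cond (F := fun v : 'I_n => v.+1)).
by rewrite inE vE abi leqnn.
Qed.

Lemma set_min_conn_cut i : 1 <= i < r -> set_min (conn_cut n a b i) = a i.+1.
Proof.
move=> ir; have abi := facets_overlap ir.
have bn : b i <= n by apply: facet_ends_le; lia.
have a1 : 1 <= a i.+1 by apply: facet_starts_ge1; lia.
rewrite /set_min conn_cutE //; apply/eqP; rewrite eqn_leq; apply/andP; split.
  have [|v vE] := @vertex_of_label (a i.+1); first by rewrite a1; lia.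
  have : v \in itv (a i.+1) (b i) by rewrite inE vE abi leqnn.
  move: (mem_index_enum v); elim: (index_enum _) => // w s IH.
  rewrite inE big_cons => /predU1P[<- ->|vs vI]; first by rewrite geq_min vE leqnn.
  by case: ifP => _; rewrite ?geq_min IH ?orbT.
apply: (big_ind (fun m => a i.+1 <= m)); first by lia.
  by move=> c d ac ad; rewrite leq_min ac.
by move=> v; rewrite inE => /andP[].
Qed.

(** * Unions of separated intersections $W_j$ *)

Definition gapped (js : seq nat) :=
  [/\ sorted ltn js, {in js, forall j, 1 <= j < r} &
      {in js &, forall j k, j < k -> (b j).+1 < a k.+1}].

Definition cut_union (js : seq nat) : {set 'I_n} :=
  [set v : 'I_n | has (fun j => a j.+1 <= v.+1 <= b j) js].

Lemma cut_unionE js : {in js, forall j, 1 <= j < r} ->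
  \bigcup_(j <- js) conn_cut n a b j = cut_union js.
Proof.
elim: js => [|j js IH] jsr; first by rewrite big_nil; apply/setP => v; rewrite !inE.
rewrite big_cons IH => [|k ks]; last by apply: jsr; rewrite inE ks orbT.
by rewrite conn_cutE ?jsr ?mem_head //; apply/setP => v; rewrite !inE.
Qed.

(** Separation of neighbours in the list gives separation of all pairs: the relation is transitive
    because every $W_j$ is non-empty. *)
Lemma cut_decompositionP W js : cut_decomposition r a b W js <->
  [/\ 0 < size js, gapped js & W = cut_union js].
Proof.
have Rsep j k : 1 <= j < r -> 1 <= k < r ->
    (set_max (conn_cut n a b j) + 1 < set_min (conn_cut n a b k)) =
    ((b j).+1 < a k.+1).
  by move=> jr kr; rewrite set_max_conn_cut // set_min_conn_cut // addn1.
have range (js' : seq nat) : {in js', forall j, 1 <= j < r} <->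
    (forall j, j \in js' -> 1 <= j <= r.-1).
  by split=> H j /H; lia.
split=> [[sz [srt /range jsr] -> sep]|[sz [srt jsr sep] ->]].
  split=> //; last exact: cut_unionE.
  split=> // j k js_j js_k jk.
  have idx : index j js < index k js.
    rewrite ltnNge leq_eqVlt; apply/negP => /predU1P[E|lt].
      by move: jk; rewrite -(nth_index 0 js_j) -E nth_index // ltnn.
    by have := sorted_ltn_index ltn_trans srt _ _ js_k js_j lt; rewrite /= ltnNge ltnW.
  rewrite -Rsep ?jsr //.
  apply: (sorted_ltn_index_in _ sep) => // k1 k2 k3 /jsr r1 /jsr r2 /jsr r3.
  by rewrite !Rsep // => lt1 lt2; have := facets_overlap r1; lia.
split=> //; first by split=> //; apply/range.
  by rewrite cut_unionE.
apply: (@sub_in_sorted _ (mem js) ltn _ _ js (allss js) srt).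
by move=> j k js_j js_k jk; rewrite Rsep ?jsr //; apply: sep.
Qed.

(** * Components of the complement of a separated union *)

Section Decomposed.
Variable js : seq nat.
Hypothesis js_gapped : gapped js.
Local Notation W := (cut_union js).

(** The label of [v] is [(a j.+1).-1]: the gap makes earlier runs stop before it, and later runs
    start after it. *)
Lemma cut_union_before j (v : 'I_n) : j \in js -> v.+2 = a j.+1 -> v \notin W.
Proof.
case: js_gapped => _ jsr sep jjs vE; rewrite inE; apply/hasPn => k kjs.
case: (ltngtP j k) => [jk|kj|<-]; last by lia.
  by have := facet_starts_lt (i := j.+1) (j := k.+1) isT jk; have := jsr k kjs; lia.
by have := sep _ _ kjs jjs kj; lia.
Qed.

Lemma cut_union_after j (v : 'I_n) : j \in js -> v = b j :> nat -> v \notin W.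
Proof.
case: js_gapped => _ jsr sep jjs vE; rewrite inE; apply/hasPn => k kjs.
case: (ltngtP j k) => [jk|kj|<-]; last by lia.
  by have := sep _ _ jjs kjs jk; lia.
by have := facet_ends_lt (i := k) (j := j); have := jsr k kjs; have := jsr j jjs; lia.
Qed.

(** Outside [W] this numbers the components from left to right, starting at 0. *)
Definition comp_index (v : 'I_n) := count (fun c => c < v.+1) (map b js).

(** A facet $F_l$ with $l\le j$ ends by [b j], and one with $l>j$ starts no earlier than
    [a j.+1]. *)
Lemma facet_across j u v : 1 <= j < r -> u.+1 < a j.+1 -> b j < v.+1 -> ~~ e u v.
Proof.
move=> jr uj jv; have uv : u < v by have := facets_overlap jr; lia.
apply/negP => /(edge_facetP uv)[l lr [au vb]].
case: (ltngtP l j) => [lj|jl|E]; last by subst l; lia.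
  by have := facet_ends_lt (i := l) (j := j); lia.
suff : a j.+1 <= a l by lia.
move: jl; rewrite leq_eqVlt => /predU1P[<- //|jl].
by apply: ltnW; apply: facet_starts_lt => //; lia.
Qed.

(** An edge outside [W] cannot jump over a run. Conversely, equal indices leave no run between the
    two vertices, and successive vertices are adjacent. *)
Lemma comp_index_connect u v : u \notin W -> v \notin W ->
  connect (del_rel e W) u v = (comp_index u == comp_index v).
Proof.
case: js_gapped => _ jsr sep uW vW.
apply/idP/eqP => [cuv|].
  suff cl c : closed (del_rel e W) [pred w | comp_index w == c].
    by have := closed_connect (cl (comp_index u)) cuv; rewrite !inE eqxx => /esym/eqP.
  have half (z t : 'I_n) : z < t -> z \notin W -> e z t ->
      comp_index z = comp_index t.
    move=> zt zW ezt; apply: eq_in_count => _ /mapP[j jjs ->] /=.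
    apply/idP/idP => [|bt]; first by lia.
    rewrite ltnNge; apply/negP => zb; move: zW; rewrite inE => /hasPn/(_ j jjs).
    rewrite zb andbT -ltnNge => za.
    by have := facet_across (jsr j jjs) za bt; rewrite ezt.
  move=> z t /and3P[zW tW ezt]; rewrite !inE; congr (_ == c).
  case: (ltngtP z t) => [zt|tz|/val_inj -> //]; first exact: half.
  by apply/esym/half; rewrite // e_sym.
wlog uv : u v uW vW / u <= v => [Hw E|].
  case: (leqP u v) => [|/ltnW] le; first exact: Hw.
  by rewrite (del_rel_sym e_sym); apply: Hw.
rewrite /comp_index !count_map => /count_eq_in E.
have {}E : {in js, forall j, (b j < u.+1) = (b j < v.+1)}.
  by apply: E => j _ /=; lia.
have clear w : u <= w <= v -> w \notin W.
  move=> uwv; rewrite inE; apply/hasPn => j jjs; apply/negP => wj.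
  move: uW vW; rewrite !inE => /hasPn/(_ j jjs) + /hasPn/(_ j jjs).
  by have := E j jjs; lia.
have [d dE] : exists d, v = u + d :> nat by exists (v - u); lia.
elim: d v dE {E uv vW} clear => [|d IH] v dE clear.
  by rewrite (_ : v = u) ?connect0 //; apply: val_inj; rewrite /= dE addn0.
have lt_v' : u + d < n by have := ltn_ord v; lia.
have cut' : connect (del_rel e W) u (Ordinal lt_v').
  by apply: IH => // w /= uw; apply: clear; lia.
apply: connect_trans cut' (connect1 _).
apply/and3P; split; first by apply: clear => /=; lia.
  by apply: clear; lia.
by apply: edge_succ => /=; lia.
Qed.

(** The vertices just before and just after the run $W_j$ around [i] see [i] through $F_j$ and
    $F_{j+1}$; the run ends between them, so their indices differ. *)
Lemma cut_union_cut_point i : i \in W -> cut_point e W i.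
Proof.
case: js_gapped => _ jsr sep; rewrite inE => /hasP[j jjs /andP[ai ib]].
have jr := jsr j jjs.
have aj := facet_starts_lt (i := j) (j := j.+1).
have bj := facet_ends_lt (i := j) (j := j.+1).
have a1 : 1 <= a j by apply: facet_starts_ge1; lia.
have bn : b j.+1 <= n by apply: facet_ends_le; lia.
have [|p pE] := @vertex_of_label (a j.+1).-1; first by lia.
have [|q qE] := @vertex_of_label (b j).+1; first by lia.
have pW : p \notin W by apply: (cut_union_before jjs); lia.
have qW : q \notin W by apply: (cut_union_after jjs); lia.
exists p, q; split=> //.
- by apply/edge_facetP; first lia; exists j; lia.
- by apply/edge_facetP; first lia; exists j.+1; lia.
rewrite comp_index_connect //; apply/eqP => /=.
rewrite /comp_index !count_map => /count_eq_in E.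
have pq : {in js, subpred (fun k => b k < p.+1) (fun k => b k < q.+1)}.
  by move=> k _ /=; lia.
by have := E pq j jjs; rewrite /=; lia.
Qed.

Lemma comp_index_surj (c : 'I_(size js).+1) :
  exists2 v, v \notin W & comp_index v = c.
Proof.
case: js_gapped => srt jsr sep.
(* Index 0 is realized by the vertex labeled 1, index [i.+1] by the vertex right after the run of
   [nth 0 js i]. *)
case: c => -[|i] /= ic.
  have [v vE] := vertex_of_label (k := 1) graph_nonempty.
  have out j : j \in js -> 1 < a j.+1 <= b j.
    move=> /jsr jr; rewrite facets_overlap // andbT.
    have := facet_starts_lt (i := j) (j := j.+1); have := facet_starts_ge1 (i := j).
    by lia.
  exists v; first by rewrite inE; apply/hasPn => j /out; lia.
  rewrite /comp_index count_map (eq_in_count (a2 := pred0)) ?count_pred0 //.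
  by move=> j /out /=; lia.
have jjs : nth 0 js i \in js by apply: mem_nth.
have jr := jsr _ jjs.
have bn : b (nth 0 js i) < n.
  apply: leq_trans (_ : b (nth 0 js i).+1 <= n); last by apply: facet_ends_le; lia.
  by apply: facet_ends_lt; lia.
exists (Ordinal bn); first exact: cut_union_after jjs _.
rewrite /comp_index /=.
have := @count_leq_nth (map b js) i; rewrite size_map (nth_map 0) //; apply=> //.
rewrite sorted_map; apply: (@sub_in_sorted _ (mem js) ltn _ _ js (allss js) srt).
move=> j k jjs' kjs jk /=; apply: facet_ends_lt => //.
  by have := jsr j jjs'; lia.
by have := jsr k kjs; lia.
Qed.

Lemma card_comp_roots : #|[set comp_root e W v | v in ~: W]| = (size js).+1.
Proof.
have /choice[s sP] (c : 'I_(size js).+1) : exists v, v \notin W /\ comp_index v = c.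
  by have [v] := comp_index_surj c; exists v.
rewrite -[RHS]card_ord -(@card_imset _ _ (comp_root e W \o s)); last first.
  move=> c d /eqP; rewrite /= comp_root_eq // comp_index_connect ?(sP _).1 //.
  by rewrite !(sP _).2 => /eqP /val_inj.
apply: eq_card => w; apply/imsetP/imsetP => [[v]|[c _ ->]]; last first.
  by exists (s c); rewrite // inE (sP c).1.
rewrite inE => vW ->.
have ltc : comp_index v < (size js).+1.
  by rewrite ltnS /comp_index (leq_trans (count_size _ _)) // size_map.
exists (Ordinal ltc) => //; apply/eqP; rewrite /= comp_root_eq // comp_index_connect //.
  by rewrite (sP (Ordinal ltc)).2.
exact: (sP _).1.
Qed.

End Decomposed.

Lemma gapped_behead j js : gapped (j :: js) -> gapped js.
Proof.
move=> [srt jsr sep]; split; first exact: path_sorted srt.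
  by move=> k kjs; apply: jsr; rewrite inE kjs orbT.
by move=> k l kjs ljs; apply: sep; rewrite inE ?kjs ?ljs orbT.
Qed.

Lemma card_cut_union js : gapped js ->
  #|cut_union js| = \sum_(j <- js) #|conn_cut n a b j|.
Proof.
elim: js => [|j js IH] gap; first by rewrite big_nil; apply: eq_card0 => v; rewrite !inE.
have [srt jsr sep] := gap.
rewrite big_cons -IH; last exact: gapped_behead gap. rewrite conn_cutE ?jsr ?mem_head //.
have -> : cut_union (j :: js) = itv (a j.+1) (b j) :|: cut_union js.
  by apply/setP => v; rewrite !inE.
rewrite cardsU (_ : _ :&: _ = set0) ?cards0 ?subn0 //.
apply/setP => v; rewrite !inE; apply/negP => /andP[vj /hasP[k kjs vk]].
have jk : j < k by have /allP/(_ k kjs) := order_path_min ltn_trans srt.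
by have := sep j k (mem_head _ _); rewrite inE kjs orbT => /(_ isT jk); lia.
Qed.

(** Take for [p] and [q] the vertices outside [W] nearest to [i] on either side. The facets through
    [u], [i] and through [i], [v] join them to [u] and [v], so an edge between them would connect
    two components. *)
Lemma cut_point_run W i : i \in W -> cut_point e W i ->
  exists p q : 'I_n, [/\ [/\ p < i < q, p \notin W & q \notin W],
    forall w, p < w < q -> w \in W, e p i, e i q & ~~ e p q].
Proof.
move=> iW [u [v [uW vW eui eiv cut]]].
have neq_i w : w \notin W -> w != i by apply: contraNneq => ->.
wlog uv : u v uW vW eui eiv cut / u <= v => [Hw|].
  case: (leqP u v) => [|/ltnW] le; first exact: (Hw u v).
  by apply: (Hw v u) => //; rewrite 1?e_sym // (del_rel_sym e_sym).
have nadj x y : x \notin W -> y \notin W -> connect (del_rel e W) u x ->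
    connect (del_rel e W) y v -> ~~ e x y.
  move=> xW yW cux cyv; apply: contra cut => exy.
  apply: connect_trans cux (connect_trans (connect1 _) cyv).
  by rewrite /del_rel /= xW yW.
have uneqv : u != v by apply: contraNneq cut => ->; apply: connect0.
(* If [i] came before [u], the facet through [i] and [v] would contain [u] and make [u] and [v]
   adjacent. *)
have ui : u < i.
  rewrite ltn_neqAle neq_i //= leqNgt; apply/negP => iu.
  have iv : i < v by apply: leq_trans uv.
  move: eiv => /(edge_facetP iv)[l lr [ai vb]].
  have /negP[] := nadj u v uW vW (connect0 _ _) (connect0 _ _).
  by apply/edge_facetP; [rewrite ltn_neqAle uneqv|exists l => //; lia].
have iv : i < v.
  rewrite ltn_neqAle eq_sym neq_i //= leqNgt; apply/negP => vi.
  move: eui => /(edge_facetP ui)[l lr [au ib]].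
  have /negP[] := nadj u v uW vW (connect0 _ _) (connect0 _ _).
  by apply/edge_facetP; [rewrite ltn_neqAle uneqv|exists l => //; lia].
pose P := [pred w : 'I_n | (w < i) && (w \notin W)].
pose Q := [pred w : 'I_n | (i < w) && (w \notin W)].
have Pu : P u by rewrite /= ui.
have Qv : Q v by rewrite /= iv.
case: (arg_maxnP (fun w : 'I_n => w : nat) Pu) => p /= /andP[pi pW] pmax.
case: (arg_minnP (fun w : 'I_n => w : nat) Qv) => q /= /andP[iq qW] qmin.
have up : u <= p by apply: pmax; rewrite /= ui.
have qv : q <= v by apply: qmin; rewrite /= iv.
have [l lr [au ib]] := edge_facetP ui eui.
have [l' lr' [ai vb]] := edge_facetP iv eiv.
exists p, q; split.
- by rewrite pi iq.
- move=> w /andP[pw wq]; apply: contraT => wW.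
  case: (ltngtP w i) => [wi|iw|/val_inj E]; last by rewrite E iW in wW.
    by have := pmax w; rewrite /= wi wW leqNgt pw => /(_ isT).
  by have := qmin w; rewrite /= iw wW leqNgt wq => /(_ isT).
- by apply/edge_facetP => //; exists l => //; split=> //; apply: leq_trans au _.
- by apply/edge_facetP => //; exists l' => //; split=> //; apply: leq_trans vb.
apply: nadj => //.
  move: up; rewrite leq_eqVlt => /predU1P[/val_inj <-|up]; first exact: connect0.
  apply: connect1; rewrite /del_rel /= uW pW.
  apply/edge_facetP => //; exists l => //; split=> //.
  by apply: leq_trans ib; apply: ltnW.
move: qv; rewrite leq_eqVlt => /predU1P[/val_inj <-|qv]; first exact: connect0.
apply: connect1; rewrite /del_rel /= vW qW.
apply/edge_facetP => //; exists l' => //; split=> //.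
by apply: leq_trans ai _; apply: ltnW.
Qed.

(** The indices collected are those [k] for which $W_k$ is a maximal run of [W]; the main point is
    that these runs cover [W]. *)
Lemma cut_point_decomposition W : W != set0 -> (forall i, i \in W -> cut_point e W i) ->
  exists js, cut_decomposition r a b W js.
Proof.
move=> W0 cutW.
pose run k := [forall v : 'I_n, (a k.+1 <= v.+1 <= b k) ==> (v \in W)] &&
  [forall v : 'I_n, ((v.+2 == a k.+1) || (v == b k :> nat)) ==> (v \notin W)].
pose js := [seq k <- iota 1 r.-1 | run k].
have jsP k : k \in js -> [/\ 1 <= k < r,
    forall v : 'I_n, a k.+1 <= v.+1 <= b k -> v \in W,
    forall v : 'I_n, v.+2 = a k.+1 -> v \notin W
  & forall v : 'I_n, v = b k :> nat -> v \notin W].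
  rewrite mem_filter mem_iota => /andP[/andP[/forallP H1 /forallP H2] kr].
  split; [lia|by move=> v; apply/implyP|move=> v vE|move=> v vE].
    by have /implyP := H2 v; apply; rewrite vE eqxx.
  by have /implyP := H2 v; apply; rewrite vE eqxx orbT.
have cover i : i \in W -> exists2 k, k \in js & a k.+1 <= i.+1 <= b k.
  move=> iW; have [p [q [[/andP[pi iq] pW qW] inW _ _ npq]]] := cut_point_run iW (cutW i iW).
  have pq : p < q by lia.
  have lt1 : q.-1 < n by have := ltn_ord q; lia.
  have lt2 : p.+1 < n by have := ltn_ord q; lia.
  (* All vertices of a run share the boundary vertices [p] and [q], hence are adjacent to both. *)
  have uniq_run w : p < w < q -> e p w /\ e w q.
    move=> pwq; have wW := inW w pwq.
    have [p' [q' [[/andP[pw wq] pW' qW'] inW' epw ewq _]]] := cut_point_run wW (cutW w wW).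
    have -> : p = p'.
      apply: val_inj => /=; case: (ltngtP p p') => // H.
        by case/negP: pW'; apply: inW; lia.
      by case/negP: pW; apply: inW'; lia.
    have -> // : q = q'.
    apply: val_inj => /=; case: (ltngtP q q') => // H.
      by case/negP: qW; apply: inW'; lia.
    by case/negP: qW'; apply: inW; lia.
  (* The last vertex of the run shares a facet $F_k$ with [p], the first one a facet $F_l$ with [q];
     no facet contains both [p] and [q]. *)
  have [|ep _] := uniq_run (Ordinal lt1); first by rewrite /=; lia.
  have [|_ eq] := uniq_run (Ordinal lt2); first by rewrite /=; lia.
  have [|k kr [/= ak bk]] := edge_facetP _ ep; first by rewrite /=; lia.
  have [|l lr [/= al bl]] := edge_facetP _ eq; first by rewrite /=; lia.
  have sep m : 1 <= m <= r -> ~ (a m <= p.+1 /\ q.+1 <= b m).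
    by move=> mr H; move/negP: npq; apply; apply/edge_facetP => //; exists m.
  have kl : k < l.
    rewrite ltnNge leq_eqVlt; apply/negP => /predU1P[E|lk].
      by apply: (sep k) => //; subst l.
    apply: (sep k) => //; split=> //.
    by have := facet_ends_lt (i := l) (j := k); lia.
  (* So $F_k$ ends and $F_l$ starts with the run. If $l>k+1$, then $F_{k+1}$ would contain both [p]
     and [q]. *)
  have akl : a k.+1 = p.+2 /\ b k = q.
    have bkq : b k = q by have := sep k kr; lia.
    split=> //; have alp : a l = p.+2 by have := sep l lr; lia.
    move: kl; rewrite leq_eqVlt => /predU1P[-> //|kl].
    have := facet_starts_lt (i := k.+1) (j := l) isT kl.
    have := facet_ends_lt (i := k) (j := k.+1).
    by have := sep k.+1; lia.
  exists k; last by lia.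
  rewrite mem_filter mem_iota; apply/andP; split; last by lia.
  case: akl => akE bkE; apply/andP; split; apply/forallP => v; apply/implyP.
    by rewrite akE bkE => H; apply: inW; lia.
  rewrite akE bkE => /orP[/eqP E|/eqP E].
    by rewrite (_ : v = p) //; apply: val_inj; case: E.
  by rewrite (_ : v = q) //; apply: val_inj.
exists js; apply/cut_decompositionP; split.
- case/set0Pn: W0 => i /cover[k kjs _].
  by case: (js) kjs.
- split.
  + by apply: sorted_filter; [exact: ltn_trans|exact: iota_ltn_sorted].
  + by move=> k /jsP[].
  move=> j k /jsP[jr jin _ _] /jsP[kr _ kbef _] jk; rewrite ltnNge; apply/negP => le.
  have ajk := facet_starts_lt (i := j.+1) (j := k.+1) isT jk.
  have akn : a k.+1 <= n by have [] := @facet_nonempty k.+1; lia.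
  have aj1 : 1 <= a j.+1 by apply: facet_starts_ge1; lia.
  (* Without the gap, the vertex just before $W_k$ would lie in $W_j$, hence in [W]. *)
  have [|p pE] := @vertex_of_label (a k.+1).-1; first by lia.
  have /negP[] : p \notin W by apply: kbef; lia.
  by apply: jin; lia.
apply/setP => v; rewrite inE; apply/idP/hasP => [/cover[k]|[k /jsP[_ kin _ _]]].
  by exists k.
exact: kin.
Qed.

End ClosedGraphs.

Theorem proposition1p4 (K : fieldType) (n : nat) (e : rel 'I_n)
  (r : nat) (a b : nat -> nat)
  (e_sym : symmetric e) (e_irr : irreflexive e)
  (e_conn : connected_graph e)
  (e_closed : closed_with_facets e r a b)
  (W : {set 'I_n}) (W_neq0 : W != set0) :
  (cut_set K e W <-> exists js : seq nat, cut_decomposition r a b W js) /\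
  (forall js : seq nat, cut_decomposition r a b W js ->
     exists d : nat,
       [/\ has_krull_dim (quotPW K e W) d,
           d <= n + 1 &
           d = n + 1 <-> (forall j, j \in js -> #|conn_cut n a b j| = 1)]).
Proof.
have decP := cut_decompositionP e_sym e_conn e_closed W.
split.
  split=> [/(cut_setP K e_sym W_neq0) cutW|[js /decP[_ gap WE]]].
    exact: cut_point_decomposition cutW.
  apply/(cut_setP K e_sym W_neq0); rewrite WE.
  by move=> i; apply: (cut_union_cut_point e_sym e_conn e_closed gap).
move=> js /decP[sz gap WE].
(* This is $n-|W|+c(W)$, with components counted by their representatives. *)
exists (#|~: W| + #|[set comp_root e W v | v in ~: W]|).
have Wn : #|W| + #|~: W| = n by rewrite cardsC card_ord.
have cardW := card_cut_union e_closed gap.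
(* Each $W_j$ contains the vertex labeled [b j], so $|W|\ge t$ with equality only for singletons,
   while $c(W)=t+1$. *)
have [|le_sz eq_sz] := @sum_seq_eq_size _ (fun j => #|conn_cut n a b j|) js.
  move=> j jjs; have jr : 1 <= j < r by case: gap => _ /(_ j jjs).
  rewrite card_gt0; apply/set0Pn.
  have ov := facets_overlap e_sym e_conn e_closed jr.
  have bn : b j <= n by apply: (facet_ends_le e_closed); lia.
  have a1 : 1 <= a j.+1 by apply: (facet_starts_ge1 e_closed); lia.
  have [|v vE] := @vertex_of_label n (b j); first by lia.
  by exists v; rewrite (conn_cutE e_closed) // inE vE ov leqnn.
have rootsE := card_comp_roots e_sym e_conn e_closed gap.
have bound w w' s : w + w' = n -> s <= w -> w' + s.+1 <= n + 1 by lia.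
have bound_eq w w' s : w + w' = n -> s <= w -> w' + s.+1 = n + 1 <-> w = s by lia.
rewrite -cardW in le_sz eq_sz; rewrite WE in Wn.
split; first exact: quotPW_krull_dim.
  by rewrite WE rootsE; apply: bound Wn le_sz.
by rewrite -eq_sz WE rootsE; apply: bound_eq Wn le_sz.
Qed.
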